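(* Let $\varphi\in\mathcal S(\mathbb C^+;\mathcal U,\mathcal Y)$ and let $\mathcal H_o$ be the reproducing kernel Hilbert space of $\mathcal Y$-valued functions on $\mathbb C^+$ with reproducing kernel $K_o(\mu,\lambda)=\frac{1-\varphi(\mu)\varphi(\lambda)^*}{\mu+\overline\lambda}$. Define an unbounded operator $S_o=\begin{bmatrix}A\&B\\ C\&D\end{bmatrix}_o$, mapping a dense subspace of $\begin{bmatrix}\mathcal H_o\\ \mathcal U\end{bmatrix}$ into $\begin{bmatrix}\mathcal H_o\\ \mathcal Y\end{bmatrix}$, by $$S_o:\begin{bmatrix}x\\ u\end{bmatrix}\mapsto\begin{bmatrix}z\\ y\end{bmatrix},\qquad z(\mu):=\mu x(\mu)+\varphi(\mu)u-y,\ \ \mu\in\mathbb C^+,\qquad (1)$$ $$y:=\lim_{\mathrm{Re}\,\eta\to\infty}\big(\eta x(\eta)+\varphi(\eta)u\big),\qquad (2)$$ on the domain $$\mathrm{dom}(S_o):=\left\{\begin{bmatrix}x\\ u\end{bmatrix}\in\begin{bmatrix}\mathcal H_o\\ \mathcal U\end{bmatrix}\ \Big|\ \exists y\in\mathcal Y:\ z\text{ defined in (1) lies in }\mathcal H_o\right\}.$$ Then for every $\begin{bmatrix}x\\ u\end{bmatrix}\in\mathrm{dom}(S_o)$ the $y\in\mathcal Y$ such that $z$ given in (1) lies in $\mathcal H_o$ is unique and is given by (2). Moreover: 1. $S_o$ is an observable co-energy-preserving system node (on $(\mathcal U,\mathcal H_o,\mathcal Y)$). 2. $S_o$ is a realization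 of $\varphi$. 3. If $S=\begin{bmatrix}A\&B\\ C\&D\end{bmatrix}:\begin{bmatrix}\mathcal X\\ \mathcal U\end{bmatrix}\supset\mathrm{dom}(S)\to\begin{bmatrix}\mathcal X\\ \mathcal Y\end{bmatrix}$ is another operator with properties 1 and 2 (with the Hilbert space $\mathcal X$ in place of $\mathcal H_o$), then there is a unitary operator $\Delta:\mathcal H_o\to\mathcal X$ such that $\begin{bmatrix}\Delta&0\\ 0&1_{\mathcal U}\end{bmatrix}$ maps $\mathrm{dom}(S_o)$ one-to-one onto $\mathrm{dom}(S)$ and $$\begin{bmatrix}\Delta&0\\ 0&1_{\mathcal Y}\end{bmatrix}S_o=S\begin{bmatrix}\Delta&0\\ 0&1_{\mathcal U}\end{bmatrix}.$$ Hence the system nodes $S$ and $S_o$ are unitarily similar.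
   Context: $\mathbb C^+=\{\lambda\in\mathbb C:\mathrm{Re}\,\lambda>0\}$; $\mathcal U,\mathcal Y$ are separable Hilbert spaces; $\mathcal S(\mathbb C^+;\mathcal U,\mathcal Y)$ (Schur class) is the set of holomorphic functions $\mathbb C^+\to\mathcal B(\mathcal U,\mathcal Y)$ whose values are contractions. $\begin{bmatrix}\mathcal X\\ \mathcal U\end{bmatrix}$ is the orthogonal direct sum. The kernel $K_o$ is positive, so $\mathcal H_o$ exists: it contains $K_o(\cdot,\lambda)y$ for $\lambda\in\mathbb C^+$, $y\in\mathcal Y$, and $\langle f,K_o(\cdot,\lambda)y\rangle_{\mathcal H_o}=\langle f(\lambda),y\rangle_{\mathcal Y}$ for $f\in\mathcal H_o$. Rigged spaces. If $A$ generates a $C_0$-semigroup on a Hilbert space $\mathcal X$, fix $\beta$ in the resolvent set $\mathrm{res}(A)$. Let $\mathcal X_1=\mathrm{dom}(A)$ with norm $\|(\beta-A)x\|_{\mathcal X}$, and let $\mathcal X_{-1}$ be the completion of $\mathcal X$ in the norm $\|(\beta-A)^{-1}x\|_{\mathcal X}$ (different $\beta$ give equivalent norms). $A|_{\mathcal X}:\mathcal X\to\mathcal X_{-1}$ is the unique continuous extension of $A$; $\mathrm{res}(A|_{\mathcal X})=\mathrm{res}(A)$. System node. A linear operator $S=\begin{bmatrix}A\&B\\ C\&D\end{bmatrix}:\begin{bmatrix}\mathcal X\\ \mathcal U\end{bmatrix}\supset\mathrm{dom}(S)\to\begin{bmatrix}\mathcal X\\ \mathcal Y\end{bmatrix}$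 (with component rows $[A\&B]$ and $[C\&D]$) is a system node on $(\mathcal U,\mathcal X,\mathcal Y)$ if: (i) $S$ is closed; (ii) $Ax:=[A\&B]\begin{bmatrix}x\\ 0\end{bmatrix}$ with $\mathrm{dom}(A)=\{x\in\mathcal X:\begin{bmatrix}x\\ 0\end{bmatrix}\in\mathrm{dom}(S)\}$ generates a $C_0$-semigroup on $\mathcal X$; (iii) $[A\&B]$ extends to a continuous operator $[A|_{\mathcal X}\ \ B]:\begin{bmatrix}\mathcal X\\ \mathcal U\end{bmatrix}\to\mathcal X_{-1}$; (iv) $\mathrm{dom}(S)=\{\begin{bmatrix}x\\ u\end{bmatrix}:A|_{\mathcal X}x+Bu\in\mathcal X\}$. $A$ and $B$ are the main and control operators, $C:\mathrm{dom}(A)\to\mathcal Y$, $Cx=[C\&D]\begin{bmatrix}x\\ 0\end{bmatrix}$, is the observation operator, and the transfer function is $\widehat{\mathfrak D}(\mu)=[C\&D]\begin{bmatrix}(\mu-A|_{\mathcal X})^{-1}B\\ 1\end{bmatrix}$, $\mu\in\mathrm{res}(A)$. $S$ is a realization of $\varphi$ if its transfer function coincides with $\varphi$ on some right half-plane $\{\mathrm{Re}\,\mu>\omega\}\subset\mathrm{res}(A)\cap\mathrm{dom}(\varphi)$, $\omega\in\mathbb R$. A system node $S$ is energy preserving if $\langle z,x\rangle_{\mathcal X}+\langle x,z\rangle_{\mathcal X}=\|u\|^2_{\mathcal U}-\|y\|^2_{\mathcal Y}$ for all $\begin{bmatrix}x\\ u\end{bmatrix}\in\mathrm{dom}(S)$,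 $\begin{bmatrix}z\\ y\end{bmatrix}=S\begin{bmatrix}x\\ u\end{bmatrix}$; it is co-energy preserving if its Hilbert-space adjoint $S^*$ (which is a system node on $(\mathcal Y,\mathcal X,\mathcal U)$) is energy preserving. Let $\rho_\infty(A)$ be the component of $\mathrm{res}(A)$ containing some right half-plane; $S$ is observable if $\bigcap_{\mu\in\rho_\infty(A)}\ker\big(C(\mu-A)^{-1}\big)=\{0\}$. *)

(* Defs.v *)
From HB Require Import structures.
From mathcomp Require Import all_boot all_order all_algebra.
From mathcomp Require Import complex.
From mathcomp Require Import boolp classical_sets functions cardinality reals.
From mathcomp Require Import topology normedtype.

Set Implicit Arguments.
Unset Strict Implicit.
Unset Printing Implicit Defensive.

Import Order.TTheory GRing.Theory Num.Theory.
Import numFieldNormedType.Exports.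

Local Open Scope classical_set_scope.
Local Open Scope ring_scope.
Local Open Scope complex_scope.

(* Complex Hilbert spaces; [ip] is linear in its first argument. The norm of a
   normed module over [R[i]] takes its values in the nonnegative reals seen
   inside [R[i]]. *)
HB.mixin Record isHilbert (R : realType) H & CompleteNormedModule R[i] H := {
  ip : H -> H -> R[i] ;
  ip_linearl : forall a x y z, ip (a *: x + y) z = a * ip x z + ip y z ;
  ip_conj : forall x y, ip y x = (ip x y)^* ;
  ip_norm : forall x, `|x| ^+ 2 = ip x x }.

#[short(type="hilbertType")]
HB.structure Definition Hilbert (R : realType) :=
  { H of CompleteNormedModule R[i] H & isHilbert R H }.

(* The inner product of the orthogonal direct sum. The topology of the product
   type is that of the direct sum, but its library norm is the max norm. *)
Definition ip2 (R : realType) (V W : hilbertType R) (p q : V * W) : R[i] :=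
  ip p.1 q.1 + ip p.2 q.2.

Definition separable (T : topologicalType) : Prop :=
  exists2 D : set T, countable D & dense D.

Definition unitary (R : realType) (V W : hilbertType R)
    (f : {linear V -> W}) : Prop :=
  bijective f /\ forall x y, ip (f x) (f y) = ip x y.

(* Hilbert-space adjoint of a bounded operator; [adj T y] is the vector that
   the Riesz theorem provides. *)
Definition adj (R : realType) (V W : hilbertType R) (T : V -> W) (w : W) : V :=
  xget 0 [set v | forall x, ip (T x) w = ip x v].

Definition Cplus (R : realType) : set R[i] := [set l | 0 < complex.Re l].

Definition half_plane (R : realType) (w : R) : set R[i] :=
  [set l | w < complex.Re l].

(* The filter of [Re eta --> +oo], uniformly in the imaginary part. *)
Definition Re_pinfty (R : realType) : set_system R[i] :=
  [set P | exists M : R, half_plane M `<=` P].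

(* An unbounded operator is identified with its graph. *)
Definition linear_op (R : realType) (V W : lmodType R[i])
    (S : set (V * W)) : Prop :=
  [/\ S 0,
      forall (a : R[i]) p q, S p -> S q -> S (a *: p + q) &
      forall v w w', S (v, w) -> S (v, w') -> w = w'].

Definition dom (V W : Type) (S : set (V * W)) : set V :=
  [set v | exists w, S (v, w)].

(* Resolvent set of [A]: [l - A] is a bijection from [dom A] onto [X], with a
   bounded inverse. *)
Definition res (R : realType) (X : normedModType R[i])
    (A : set (X * X)) : set R[i] :=
  [set l | (forall v, exists! x, exists2 z, A (x, z) & l *: x - z = v) /\
           exists M : R[i], forall x z, A (x, z) -> `|x| <= M * `|l *: x - z|].

Definition resolvent (R : realType) (X : normedModType R[i])
    (A : set (X * X)) (l : R[i]) (v : X) : X :=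
  xget 0 [set x | exists2 z, A (x, z) & l *: x - z = v].

Record C0_semigroup (R : realType) (X : normedModType R[i])
    (T : R -> {linear X -> X}) : Prop := {
  C0_continuous : forall t, 0 <= t -> continuous (T t) ;
  C0_id : forall x, T 0 x = x ;
  C0_add : forall s t x, 0 <= s -> 0 <= t -> T (s + t) x = T s (T t x) ;
  C0_strong : forall x, T t x @[t --> 0^'+] --> x }.

Definition generator (R : realType) (X : normedModType R[i])
    (T : R -> {linear X -> X}) : set (X * X) :=
  [set p | (t^-1)%:C *: (T t p.1 - p.1) @[t --> 0^'+] --> p.2].

Definition generates_C0 (R : realType) (X : normedModType R[i])
    (A : set (X * X)) : Prop :=
  exists2 T : R -> {linear X -> X}, C0_semigroup T & A = generator T.

(* The space [X_{-1}]: a completion of [X] in the norm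
   [x |-> `|(beta - A)^-1 x|], given as a Banach space with a dense isometric
   embedding. *)
Record rigging (R : realType) (X : normedModType R[i]) (A : set (X * X)) :=
  Rigging {
  rig_beta : R[i] ;
  rig_beta_res : res A rig_beta ;
  rig_space : completeNormedModType R[i] ;
  rig_emb : {linear X -> rig_space} ;
  rig_norm : forall x, `|rig_emb x| = `|resolvent A rig_beta x| ;
  rig_dense : dense (range rig_emb) }.

Section SystemNodes.
Variables (R : realType) (U X Y : hilbertType R).
Implicit Type S : set ((X * U) * (X * Y)).

Definition main_op S : set (X * X) :=
  [set p | exists y, S ((p.1, 0), (p.2, y))].

Definition obs_op S : set (X * Y) :=
  [set p | exists z, S ((p.1, 0), (z, p.2))].

(* The pair [ext_A] = [A|X], [ext_B] = [B] is the continuous extension of the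
   top row [A&B] to an operator from [X (+) U] into [X_{-1}]. *)
Record node_ext S (rg : rigging (main_op S)) := NodeExt {
  ext_A : {linear X -> rig_space rg} ;
  ext_B : {linear U -> rig_space rg} ;
  ext_A_continuous : continuous ext_A ;
  ext_B_continuous : continuous ext_B ;
  ext_AB : forall x u z y, S ((x, u), (z, y)) ->
    ext_A x + ext_B u = rig_emb rg z ;
  ext_dom : dom S =
    [set v | exists z, ext_A v.1 + ext_B v.2 = rig_emb rg z] }.

Definition system_node S : Prop :=
  [/\ linear_op S, closed S, generates_C0 (main_op S) &
      exists rg : rigging (main_op S), inhabited (node_ext rg)].

(* [(mu - A|X)^-1], as an operator from [X_{-1}] to [X]. *)
Definition ext_resolvent S (rg : rigging (main_op S)) (E : node_ext rg)
    (mu : R[i]) (v : rig_space rg) : X :=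
  xget 0 [set x | mu *: rig_emb rg x - ext_A E x = v].

Definition CD_row S (v : X * U) : Y :=
  xget 0 [set y | exists z, S (v, (z, y))].

Definition transfer_function S (rg : rigging (main_op S)) (E : node_ext rg)
    (mu : R[i]) (u : U) : Y :=
  CD_row S (ext_resolvent E mu (ext_B E u), u).

(* The domain of [phi] is [C^+], whatever its values elsewhere. *)
Definition realization S (phi : R[i] -> {linear U -> Y}) : Prop :=
  exists (rg : rigging (main_op S)) (E : node_ext rg) (w : R),
    half_plane w `<=` res (main_op S) `&` @Cplus R /\
    forall mu, half_plane w mu ->
      forall u, transfer_function E mu u = phi mu u.

(* The component of the resolvent set that contains a right half-plane. *)
Definition rho_infty (A : set (X * X)) : set R[i] :=
  [set mu | exists w : R,
    half_plane w `<=` connected_component (res A : set R[i]^o) mu].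

Definition observable S : Prop :=
  forall x, (forall mu, rho_infty (main_op S) mu ->
               obs_op S (resolvent (main_op S) mu x, 0)) -> x = 0.

End SystemNodes.

Definition adjoint_op (R : realType) (U X Y : hilbertType R)
    (S : set ((X * U) * (X * Y))) : set ((X * Y) * (X * U)) :=
  [set p | forall v w, S (v, w) -> ip2 w p.1 = ip2 v p.2].

Definition energy_preserving (R : realType) (U X Y : hilbertType R)
    (S : set ((X * U) * (X * Y))) : Prop :=
  forall x u z y, S ((x, u), (z, y)) ->
    ip z x + ip x z = `|u| ^+ 2 - `|y| ^+ 2.

Definition co_energy_preserving (R : realType) (U X Y : hilbertType R)
    (S : set ((X * U) * (X * Y))) : Prop :=
  energy_preserving (adjoint_op S).

(* Complex differentiability in operator norm at each point of [C^+]. *)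
Definition holomorphic (R : realType) (U Y : hilbertType R)
    (phi : R[i] -> {linear U -> Y}) : Prop :=
  forall l, Cplus l -> exists2 T : {linear U -> Y}, continuous T &
    forall e : R[i], 0 < e -> \forall h \near (0 : R[i]^o)^', forall u,
      `|(h : R[i])^-1 *: (phi (l + h) u - phi l u) - T u| <= e * `|u|.

(* Values outside [C^+] are irrelevant. *)
Definition schur (R : realType) (U Y : hilbertType R)
    (phi : R[i] -> {linear U -> Y}) : Prop :=
  holomorphic phi /\ forall l, Cplus l -> forall u, `|phi l u| <= `|u|.

(* [H] is the Hilbert space of [Y]-valued functions on [C^+] with reproducing
   kernel [K]; the element [f : H] stands for the function [ev f], whose values
   outside [C^+] are irrelevant. *)
Record is_RKHS (R : realType) (Y H : hilbertType R) (ev : H -> R[i] -> Y)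
    (K : R[i] -> R[i] -> Y -> Y) : Prop := {
  rkhs_linear : forall mu, Cplus mu -> forall a f g,
    ev (a *: f + g) mu = a *: ev f mu + ev g mu ;
  rkhs_ext : forall f g,
    (forall mu, Cplus mu -> ev f mu = ev g mu) -> f = g ;
  rkhs_kernel : forall l y, Cplus l -> exists2 k : H,
    (forall mu, Cplus mu -> ev k mu = K mu l y) &
    (forall f, ip f k = ip (ev f l) y) }.

Section Model.
Variables (R : realType) (U Y H : hilbertType R).
Variables (phi : R[i] -> {linear U -> Y}) (ev : H -> R[i] -> Y).

Definition K_o (mu l : R[i]) (y : Y) : Y :=
  (mu + l^*)^-1 *: (y - phi mu (adj (phi l) y)).

Definition So_eq (x : H) (u : U) (z : H) (y : Y) : Prop :=
  forall mu, Cplus mu -> ev z mu = mu *: ev x mu + phi mu u - y.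

Definition So_lim (x : H) (u : U) (y : Y) : Prop :=
  eta *: ev x eta + phi eta u @[eta --> @Re_pinfty R] --> y.

Definition dom_So : set (H * U) :=
  [set v | exists y z, So_eq v.1 v.2 z y].

Definition S_o : set ((H * U) * (H * Y)) :=
  [set p | [/\ dom_So p.1, So_eq p.1.1 p.1.2 p.2.1 p.2.2 &
               So_lim p.1.1 p.1.2 p.2.2]].

End Model.

(* [Delta (+) 1] *)
Definition sum_id (V W Z : Type) (f : V -> W) (p : V * Z) : W * Z :=
  (f p.1, p.2).

(* The last clause is the equality of the two operators
   [(Delta (+) 1_Y) S] and [S' (Delta (+) 1_U)] as graphs. *)
Definition intertwines (R : realType) (U Y H X : hilbertType R)
    (S : set ((H * U) * (H * Y))) (S' : set ((X * U) * (X * Y)))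
    (Delta : H -> X) : Prop :=
  set_bij (dom S) (dom S') (sum_id Delta) /\
  [set p : (H * U) * (X * Y) | exists2 w, S (p.1, w) & p.2 = sum_id Delta w] =
  [set p | S' (sum_id Delta p.1, p.2)].

(* Main.v *)
Require Import Defs.
From HB Require Import structures.
From mathcomp Require Import all_boot all_order all_algebra.
From mathcomp Require Import complex.
From mathcomp Require Import boolp classical_sets functions cardinality reals.
From mathcomp Require Import topology normedtype.
From mathcomp Require Import ring lra.

(* The reproducing property makes [S_o] the adjoint of the relation spanned by
   the pairs of [(k_l y, y)] and [(conj l k_l y, phi(l)^* y)], where
   [k_l y = K_o(., l) y]. The energy form vanishes on this relation, so its
   Cayley transforms are isometries; their adjoints solve
   [(b - A) x = f] for every [b] in [C^+] and show that [S_o] is passive. Hence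
   the main operator is maximal dissipative and generates a contraction
   semigroup. Up to signs [S_o] extends the spanning relation, and co-energy
   preservation follows by pairing an element of [S_o^*] with itself.
   For another realization [S], put [e_l y = (C (l - A)^-1)^* y]. Polarizing the
   energy identity of [S^*] gives the [e_l y] the Gram matrix of the [k_l y], for
   [l] in some right half-plane. Both families are total: the annihilator of such
   a family is invariant under the resolvents there, hence on the whole component
   of the resolvent set. So [k_l y |-> e_l y] extends to a unitary operator. It
   carries [S] into [S_o], and solving the resolvent equation in [S] gives the
   reverse inclusion. *)

(** A resolvent equation in function form reads [(b - m) d(m) = 0] and says nothing at [m = b]. The
    missing value comes from the Gram identity, which makes the kernel vectors norm-continuous along
    rightward real shifts ([gram_continuous]). It applies to the [k_l y] and to the [e_l y] alike,
    because both families satisfy the same identity. A realization is tied to [phi] only on some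
    half-plane [w < Re l], so facts about it must be carried from there to [C^+] or to a component
    of the resolvent set. Instead of analytic continuation, a strict-contraction argument moves the
    invariance of an annihilator from one resolvent point to a nearby one ([resolvent_invariance]).
    The relations involved are spans, neither closed nor known in advance to be single-valued. Hence
    Riesz representation is proved for bounded linear relations on subspaces, and no extension by
    continuity is made. *)

Set Implicit Arguments.
Unset Strict Implicit.
Unset Printing Implicit Defensive.

Import Order.TTheory GRing.Theory Num.Theory.
Import numFieldNormedType.Exports.

Local Open Scope classical_set_scope.
Local Open Scope ring_scope.
Local Open Scope complex_scope.

Local Notation Re := complex.Re.
Local Notation Im := complex.Im.

(** * Complex parts and real-valued norms *)

Section ComplexParts.
Variable R : realType.
Implicit Types (a b : R[i]) (r : R).

Lemma ReD a b : Re (a + b) = Re a + Re b. Proof. by case: a; case: b. Qed.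
Lemma ReN a : Re (- a) = - Re a. Proof. by case: a. Qed.
Lemma ReB a b : Re (a - b) = Re a - Re b. Proof. by rewrite ReD ReN. Qed.
Lemma Re_conjc a : Re (conjc a) = Re a. Proof. by case: a. Qed.
Lemma conjCE a : Num.conj a = conjc a. Proof. by []. Qed.
Lemma conjc_realE r : conjc r%:C = r%:C. Proof. exact: conjc_real. Qed.
Lemma conjcD a b : conjc (a + b) = conjc a + conjc b.
Proof. exact: rmorphD. Qed.
Lemma conjcN a : conjc (- a) = - conjc a. Proof. exact: rmorphN. Qed.
Lemma conjcM a b : conjc (a * b) = conjc a * conjc b.
Proof. exact: rmorphM. Qed.
Lemma conjcKE a : conjc (conjc a) = a. Proof. exact: conjcK. Qed.
Lemma ReZ r a : Re (r%:C * a) = r * Re a.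
Proof. by case: a => x y /=; rewrite mul0r subr0. Qed.
Lemma Rei a : Re ('i * a) = - Im a.
Proof. by rewrite mulrC ReiNIm. Qed.

Lemma complex_eqP a b : Re a = Re b -> Im a = Im b -> a = b.
Proof. by case: a b => [x y] [z t] /= -> ->. Qed.

Lemma normc_real r : 0 <= r -> `|r%:C| = r%:C :> R[i].
Proof. by move=> r0; rewrite ger0_norm // ler0c. Qed.

Lemma ge0_ReE a : 0 <= a -> a = (Re a)%:C.
Proof. by move=> /ger0_Im h; apply: complex_eqP. Qed.

Lemma Re_norm_ge0 a : 0 <= Re `|a|.
Proof. by have := normr_ge0 a; rewrite lecE => /andP[]. Qed.

Lemma Re_normM a b : Re `|a * b| = Re `|a| * Re `|b|.
Proof.
by rewrite normrM (ge0_ReE (normr_ge0 a)) (ge0_ReE (normr_ge0 b)) -rmorphM.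
Qed.

Lemma Re_norm_sqr a : Re `|a| ^+ 2 = Re a ^+ 2 + Im a ^+ 2.
Proof.
apply: complexI; rewrite rmorphXn /= -(ge0_ReE (normr_ge0 a)).
by rewrite -add_Re2_Im2.
Qed.

Lemma Re_normB_sqr a b :
  Re `|a - b| ^+ 2 = (Re a - Re b) ^+ 2 + (Im a - Im b) ^+ 2.
Proof. by rewrite Re_norm_sqr; case: a b => [x y] [s t]. Qed.

End ComplexParts.

Lemma le0_eps (R : realType) (x : R) :
  (forall e : R, 0 < e -> x <= e) -> x <= 0.
Proof. by move=> h; apply/ler_addgt0Pr => e e0; rewrite add0r h. Qed.

Section RealNorm.
Variables (R : realType) (V : normedModType R[i]).
Implicit Types (x y z : V) (a : R[i]).

(** The norm takes values in the partially ordered [R[i]]; its real part is open to real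
    arithmetic. *)
Definition hn x : R := Re `|x|.

Lemma hnE x : `|x| = (hn x)%:C.
Proof. by rewrite /hn -ge0_ReE ?normr_ge0. Qed.
Lemma hn_ge0 x : 0 <= hn x.
Proof. by rewrite -lecR -hnE normr_ge0. Qed.
Lemma hn0 : hn 0 = 0. Proof. by rewrite /hn normr0. Qed.
Lemma hnN x : hn (- x) = hn x. Proof. by rewrite /hn normrN. Qed.
Lemma hnBC x y : hn (x - y) = hn (y - x). Proof. by rewrite -opprB hnN. Qed.
Lemma hnD x y : hn (x + y) <= hn x + hn y.
Proof. by rewrite -lecR rmorphD /= -!hnE ler_normD. Qed.
Lemma hnB x y : hn (x - y) <= hn x + hn y.
Proof. by rewrite -(hnN y) hnD. Qed.
Lemma hn_tri y x z : hn (x - z) <= hn (x - y) + hn (y - z).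
Proof. by rewrite -{1}(subrK y x) -addrA hnD. Qed.
Lemma hnZ a x : hn (a *: x) = Re `|a| * hn x.
Proof.
by apply: complexI; rewrite rmorphM /= -!hnE -(ge0_ReE (normr_ge0 a)) normrZ.
Qed.
Lemma hnZr (r : R) x : 0 <= r -> hn (r%:C *: x) = r * hn x.
Proof. by move=> r0; rewrite hnZ normc_real. Qed.
Lemma hn_eq0 x : hn x = 0 -> x = 0.
Proof. by move=> h; apply/normr0_eq0; rewrite hnE h. Qed.
Lemma hn_le0 x : hn x <= 0 -> x = 0.
Proof. by move=> h; apply: hn_eq0; apply/le_anti; rewrite h hn_ge0. Qed.
Lemma hn_eps x : (forall e : R, 0 < e -> hn x <= e) -> x = 0.
Proof.
move=> h; exact/hn_le0/le0_eps.
Qed.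

Lemma cvg_hnP (T : Type) (F : set_system T) {FF : Filter F} (f : T -> V) x :
  f @ F --> x <-> forall e : R, 0 < e -> \forall t \near F, hn (x - f t) < e.
Proof.
split=> [/cvgrPdist_lt h e e0|h].
  have /h : (0 : R[i]) < e%:C by rewrite ltcR.
  by apply: filterS => t; rewrite hnE ltcR.
apply/cvgrPdist_lt => e e0; have eE := ge0_ReE (ltW e0).
have /h : 0 < Re e by rewrite -ltcR -eE.
by apply: filterS => t; rewrite hnE eE ltcR.
Qed.

Lemma cvg_hn_seqP (u : nat -> V) x :
  u @ \oo --> x <->
  forall e : R, 0 < e -> exists N, forall n, (N <= n)%N -> hn (u n - x) < e.
Proof.
rewrite cvg_hnP; split=> h e /h.
  by move=> [N _ hN]; exists N => n /hN /=; rewrite hnBC.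
by move=> [N hN]; exists N => // n /hN /=; rewrite hnBC.
Qed.

Lemma closed_hnP (A : set V) :
  closed A <-> forall x, (forall e : R, 0 < e -> exists2 a, A a & hn (x - a) < e) -> A x.
Proof.
split=> [cA x h|h x clx].
  apply: cA => B /nbhs_ballP[e e0 eB]; have eE := ge0_ReE (ltW e0).
  have /h[a Aa ha] : 0 < Re e by rewrite -ltcR -eE.
  by exists a; split=> //; apply: eB; rewrite -ball_normE /= hnE eE ltcR.
apply: h => e e0; have ec : (0 : R[i]) < e%:C by rewrite ltcR.
have [a [Aa]] := clx _ (nbhsx_ballx x _ ec).
by rewrite -ball_normE /= hnE ltcR => ha; exists a.
Qed.

Lemma dense_hnP (A : set V) :
  dense A <-> forall x (e : R), 0 < e -> exists2 a, A a & hn (x - a) < e.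
Proof.
split=> [dA x e e0|h O [x Ox] oO].
  have ec : (0 : R[i]) < e%:C by rewrite ltcR.
  have [|a [+ Aa]] := dA (ball x e%:C)^° _ (open_interior _).
    by exists x; apply: nbhsx_ballx.
  move=> /(@interior_subset _ _ _); rewrite -ball_normE /= hnE ltcR => ha.
  by exists a.
have /nbhs_ballP[e e0 eB] := open_nbhs_nbhs (conj oO Ox).
have eE := ge0_ReE (ltW e0).
have /(h x)[a Aa ha] : 0 < Re e by rewrite -ltcR -eE.
by exists a; split=> //; apply: eB; rewrite -ball_normE /= hnE eE ltcR.
Qed.

End RealNorm.

Lemma bounded_linear_continuous (R : realType) (V W : normedModType R[i])
    (f : {linear V -> W}) (M : R) :
  (forall x, hn (f x) <= M * hn x) -> continuous f.
Proof.
move=> hf x; apply/cvg_hnP => e e0.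
have M1 : 0 < `|M| + 1 by rewrite ltr_wpDl.
have := (@cvg_hnP R V _ _ (nbhs_filter x) id x).1 (@cvg_id _ _) (e / (`|M| + 1)).
rewrite divr_gt0 // => /(_ isT); apply: filterS => t ht.
rewrite -linearB; apply: le_lt_trans (hf _) _.
rewrite ltr_pdivlMr // in ht; apply: le_lt_trans ht.
rewrite mulrC ler_wpM2l ?hn_ge0 //; have := ler_norm M; lra.
Qed.

Lemma complete_hn (R : realType) (V : completeNormedModType R[i]) (u : nat -> V) :
  (forall e : R, 0 < e -> exists N, forall m n, (N <= m)%N -> (N <= n)%N ->
     hn (u m - u n) < e) ->
  exists l : V, u @ \oo --> l.
Proof.
move=> h; suff : cvg (u @ \oo) by move=> c; exists (lim (u @ \oo)).
apply: cauchy_cvg; apply/cauchy_ballP => e e0; have eE := ge0_ReE (ltW e0).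
have /h[N hN] : 0 < Re e by rewrite -ltcR -eE.
pose B := [set u n | n in [set n | (N <= n)%N]].
exists (B, B) => /=; first by split; exists N => // n /= hn'; exists n.
move=> [_ _] /= [[i hi <-] [j hj <-]].
by rewrite /= -ball_normE /= hnE eE ltcR; exact: hN.
Qed.

(** * Riesz representation for complete hermitian forms *)

(** The form lives on a bare module, so weighted direct sums qualify although the product type
    carries the max norm. Only semidefiniteness is asked. *)
Record hform (R : realType) (E : lmodType R[i]) := HForm {
  hb :> E -> E -> R[i] ;
  hb_linear : forall a x y z, hb (a *: x + y) z = a * hb x z + hb y z ;
  hb_conj : forall x y, hb y x = conjc (hb x y) ;
  hb_ge0 : forall x, 0 <= Re (hb x x) ;
  hb_complete : forall u : nat -> E,
    (forall e : R, 0 < e -> exists N, forall m n, (N <= m)%N -> (N <= n)%N ->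
       Re (hb (u m - u n) (u m - u n)) < e) ->
    exists l, forall e : R, 0 < e -> exists N, forall n, (N <= n)%N ->
       Re (hb (u n - l) (u n - l)) < e }.

Section HFormTheory.
Variables (R : realType) (E : lmodType R[i]) (b : hform E).
Implicit Types (x y z d g : E) (a c : R[i]) (r t : R).

Lemma hb0l y : b 0 y = 0.
Proof. by have := hb_linear b (-1) 0 0 y; rewrite scaler0 addr0 mulN1r addNr. Qed.
Lemma hbDl x y z : b (x + y) z = b x z + b y z.
Proof. by have := hb_linear b 1 x y z; rewrite scale1r mul1r. Qed.
Lemma hbZl a x z : b (a *: x) z = a * b x z.
Proof. by have := hb_linear b a x 0 z; rewrite hb0l !addr0. Qed.
Lemma hbNl x z : b (- x) z = - b x z.
Proof. by rewrite -scaleN1r hbZl mulN1r. Qed.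
Lemma hbBl x y z : b (x - y) z = b x z - b y z.
Proof. by rewrite hbDl hbNl. Qed.
Lemma hb0r y : b y 0 = 0. Proof. by rewrite hb_conj hb0l conjc0. Qed.
Lemma hbDr x y z : b z (x + y) = b z x + b z y.
Proof. by rewrite hb_conj hbDl rmorphD /= -!hb_conj. Qed.
Lemma hbZr a x z : b z (a *: x) = conjc a * b z x.
Proof. by rewrite hb_conj hbZl rmorphM /= -!hb_conj. Qed.
Lemma hbNr x z : b z (- x) = - b z x.
Proof. by rewrite hb_conj hbNl rmorphN /= -!hb_conj. Qed.
Lemma hbBr x y z : b z (x - y) = b z x - b z y.
Proof. by rewrite hbDr hbNr. Qed.

Lemma Re_hbC x y : Re (b x y) = Re (b y x).
Proof. by rewrite hb_conj Re_conjc. Qed.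

Lemma Re_hb_combo t x y : Re (b (x + t%:C *: y) (x + t%:C *: y)) =
  Re (b x x) + 2 * t * Re (b x y) + t ^+ 2 * Re (b y y).
Proof.
rewrite hbDl !hbDr !hbZl !hbZr conjc_realE !ReD !ReZ (Re_hbC y x).
by ring.
Qed.

Lemma cauchy_schwarz x y : Re (b x y) ^+ 2 <= Re (b x x) * Re (b y y).
Proof.
have Q t : 0 <= Re (b x x) + 2 * t * Re (b x y) + t ^+ 2 * Re (b y y).
  by rewrite -Re_hb_combo hb_ge0.
have [y0|y0] := eqVneq (Re (b y y)) 0.
  have /eqP : Re (b x y) = 0; last by move=> /eqP ->; rewrite y0 mulr0 expr0n.
  apply/eqP; have [//|n0] := eqVneq (Re (b x y)) 0.
  (* Here the quadratic is affine in [t], and this [t] gives it the value -1. *)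
  have := Q (- (Re (b x x) + 1) / (2 * Re (b x y))); rewrite y0 mulr0 addr0.
  have -> : 2 * (- (Re (b x x) + 1) / (2 * Re (b x y))) * Re (b x y) =
    - (Re (b x x) + 1) by field; rewrite n0.
  lra.
have yp : 0 < Re (b y y) by rewrite lt_neqAle eq_sym y0 hb_ge0.
have := Q (- Re (b x y) / Re (b y y)).
have -> : Re (b x x) + 2 * (- Re (b x y) / Re (b y y)) * Re (b x y) +
   (- Re (b x y) / Re (b y y)) ^+ 2 * Re (b y y) =
   (Re (b x x) * Re (b y y) - Re (b x y) ^+ 2) / Re (b y y) by field.
by rewrite pmulr_lge0 ?invr_gt0 // subr_ge0.
Qed.

Lemma Re_hbD2 x y :
  Re (b (x + y) (x + y)) <= 2 * Re (b x x) + 2 * Re (b y y).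
Proof.
have := hb_ge0 b (x - y).
rewrite !hbDl !hbDr !hbNl !hbNr !ReD !ReN (Re_hbC y x); lra.
Qed.

Lemma Re_hbBC x y : Re (b (x - y) (x - y)) = Re (b (y - x) (y - x)).
Proof. by rewrite -opprB hbNl hbNr opprK. Qed.

End HFormTheory.

Section Riesz.
Variables (R : realType) (E : lmodType R[i]) (b : hform E).
Variables (L : E -> R[i] -> Prop) (M : R).
Hypothesis L0 : L 0 0.
Hypothesis L_linear : forall a d c d' c', L d c -> L d' c' ->
  L (a *: d + d') (a * c + c').
Hypothesis L_bounded : forall d c, L d c -> Re c ^+ 2 <= M * Re (b d d).
Hypothesis M_ge0 : 0 <= M.

(** If [g] represents [L], then [F d c] is [|d - g|^2 - |g|^2], so minimising sequences approach
    [g]. [L] is a relation because in the applications [c] depends on an element lying over [d]. *)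
Let F d c := Re (b d d) - 2 * Re c.
Let m := inf [set r : R | exists d c, L d c /\ r = F d c].

Let F_ge d c : L d c -> - M <= F d c.
Proof.
move=> /L_bounded h; rewrite /F; have q0 := hb_ge0 b d.
have [//|lt] := leP (- M) (Re (b d d) - 2 * Re c).
exfalso.
have : Re (b d d) + M < 2 * Re c by lra.
move=> h1; have h2 : 0 <= Re (b d d) + M by rewrite addr_ge0.
have : (Re (b d d) + M) ^+ 2 < (2 * Re c) ^+ 2.
  by rewrite ltr_sqr ?nnegrE // (le_trans h2) // ltW.
by have := sqr_ge0 (Re (b d d) - M); nra.
Qed.

Let F_has_inf : has_inf [set r : R | exists d c, L d c /\ r = F d c].
Proof.
split; first by exists (F 0 0), 0, 0.
by exists (- M) => r [d [c [Ldc ->]]]; exact: F_ge.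
Qed.

Let m_le d c : L d c -> m <= F d c.
Proof. by move=> Ldc; apply: ge_inf => //; [case: F_has_inf|exists d, c]. Qed.

Let L_scale a d c : L d c -> L (a *: d) (a * c).
Proof. by move=> h; have := L_linear a h L0; rewrite !addr0. Qed.

(** The midpoint of two near-minimisers cannot fall below [m], so the parallelogram law makes them
    close. *)
Let parallelogram d c d' c' e : L d c -> L d' c' ->
  F d c < m + e -> F d' c' < m + e -> Re (b (d - d') (d - d')) < 4 * e.
Proof.
move=> Ldc Ldc' h h'.
have L1 : L (1 *: d + d') (1 * c + c') by exact: L_linear.
have := m_le (L_scale (2^-1 : R)%:C L1); move: h h'.
rewrite /F !scale1r !mul1r !hbZl !hbZr conjc_realE !hbDl !hbDr !hbNl !hbNr.
rewrite !ReZ !ReD !ReN (Re_hbC b d' d).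
lra.
Qed.

(** Near-minimality forces near-stationarity: move [d] by [- s * w] along [d'] with
    [s = 1 / (Q + 1)], where the 1 covers [Q = 0]. *)
Let variation d c d' c' e : L d c -> L d' c' -> F d c < m + e ->
  (Re (b d d') - Re c') ^+ 2 <= e * (Re (b d' d') + 1).
Proof.
move=> Ldc Ldc' h.
pose w := Re (b d d') - Re c'; pose Q := Re (b d' d').
have Q0 : 0 <= Q by rewrite hb_ge0.
pose s := (Q + 1)^-1; have s0 : 0 < s by rewrite invr_gt0; lra.
have sQ : s * (Q + 1) = 1 by rewrite mulVf //; lra.
have L1 : L (1 *: d + (- s * w)%:C *: d') (1 * c + (- s * w)%:C * c').
  by apply: L_linear => //; exact: L_scale.
rewrite -/Q -/w; have wE : Re (b d d') = w + Re c' by rewrite /w subrK.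
have := m_le L1; move: h; rewrite /F scale1r mul1r Re_hb_combo ReD ReZ -/Q wE.
move=> h1 h2; clearbody w.
have h3 : s * w ^+ 2 * (2 - s * Q) < e by nra.
have h4 : s * Q <= 1 by nra.
have h5 : s * w ^+ 2 <= e.
  apply: le_trans (ltW h3); rewrite ler_peMr //; last by lra.
  by apply: mulr_ge0; rewrite ?sqr_ge0 ?(ltW s0).
rewrite -(ler_pM2l s0); apply: le_trans h5 _.
by rewrite mulrCA sQ mulr1.
Qed.

(* Minimise [q(d) - 2 Re c] over [L]. *)
Lemma riesz : exists g,
  [/\ forall d c, L d c -> c = b d g, Re (b g g) <= M &
      forall e : R, 0 < e -> exists d c, L d c /\ Re (b (d - g) (d - g)) < e].
Proof.
have /choice[p hp] : forall n, exists p : E * R[i],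
    L p.1 p.2 /\ F p.1 p.2 < m + n.+1%:R^-1.
  move=> n; have [|r [d [c [Ldc ->]]] lt] := @inf_adherent R _ n.+1%:R^-1 _ F_has_inf.
    by rewrite invr_gt0 ltr0n.
  by exists (d, c).
have inv_lt (e : R) : 0 < e -> exists N, forall n, (N <= n)%N -> n.+1%:R^-1 < e.
  move=> e0; exists (Num.trunc e^-1) => n hn.
  rewrite -[e]invrK ltf_pV2 ?posrE ?ltr0n ?invr_gt0 //.
  have /andP[_] := truncn_itv (ltW (eqbRL (invr_gt0 e) e0)).
  by move=> /lt_le_trans; apply; rewrite ler_nat ltnS.
have lt_e (r s e : R) : s < e -> r < m + s -> r < m + e by move=> *; lra.
have [|g hg] := @hb_complete _ _ b (fun n => (p n).1).
  move=> e e0; have [|N hN] := inv_lt (e / 4); first by lra.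
  exists N => i j hi hj; have -> : e = 4 * (e / 4) by lra.
  have [[Li Fi] [Lj Fj]] := (hp i, hp j).
  by apply: parallelogram Li Lj _ _; [apply: lt_e (hN _ hi) Fi|apply: lt_e (hN _ hj) Fj].
have appr (e : R) : 0 < e -> exists n, [/\ L (p n).1 (p n).2,
    F (p n).1 (p n).2 < m + e & Re (b ((p n).1 - g) ((p n).1 - g)) < e].
  move=> e0; have [N hN] := inv_lt e e0; have [N' hN'] := hg e e0.
  exists (maxn N N'); have [? hF] := hp (maxn N N'); split=> //.
    by apply: lt_e hF; apply: hN; rewrite leq_maxl.
  by apply: hN'; rewrite leq_maxr.
have ReL d c : L d c -> Re c = Re (b d g).
  move=> Ldc; pose Q := Re (b d d); have Q0 : 0 <= Q by rewrite hb_ge0.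
  suff : (Re (b g d) - Re c) ^+ 2 <= 0.
    have := sqr_ge0 (Re (b g d) - Re c) => h1 h2.
    have /eqP : (Re (b g d) - Re c) ^+ 2 = 0 by apply/le_anti; rewrite h1 h2.
    by rewrite sqrf_eq0 subr_eq0 => /eqP <-; rewrite Re_hbC.
  apply/ler_addgt0Pr => e e0; rewrite add0r.
  have [|n [Ln Fn gn]] := appr (e / (4 * (Q + 1))).
    by rewrite divr_gt0 //; lra.
  have := variation Ln Ldc Fn; have := cauchy_schwarz b ((p n).1 - g) d.
  rewrite -/Q; set q := Re (b (_ - _) (_ - _)) in gn *.
  have -> : e / (4 * (Q + 1)) * (Q + 1) = e / 4 by field; lra.
  have q1 : q * Q <= e / 4.
    have -> : e / 4 = e / (4 * (Q + 1)) * (Q + 1) by field; lra.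
    have : 0 <= q by rewrite hb_ge0. by nra.
  (* [(G - Re c)^2] is at most [2 (B - G)^2 + 2 (B - Re c)^2], and each summand is at most
     [e / 2]. *)
  rewrite hbBl ReB; set B := Re (b (p n).1 d); set G := Re (b g d).
  move: (sqr_ge0 ((B - G) + (B - Re c))); nra.
(* The imaginary part follows from [ReL] at ['i *: d]. *)
have Lb d c : L d c -> c = b d g.
  move=> Ldc; apply: complex_eqP; first exact: ReL.
  have := ReL _ _ (L_scale 'i Ldc); rewrite hbZl !Rei; exact: oppr_inj.
exists g; split=> //; last first.
  by move=> e /appr[n [Ln _ ?]]; exists (p n).1, (p n).2.
suff le_e (e : R) : 0 < e -> Re (b g g) <= M + e by apply/ler_addgt0Pr.
move=> e0; have [n [Ln _]] := appr e e0.
have := L_bounded Ln; rewrite (ReL _ _ Ln); move: (p n).1 => d.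
have := cauchy_schwarz b d g; have a0 := hb_ge0 b d; have G0 := hb_ge0 b g.
rewrite hbBl !hbBr !ReB (Re_hbC b g d).
move: a0 G0; set a := Re (b d d); set G := Re (b g g); set r := Re (b d g).
move=> a0 G0 h1 h2 h3; have [//|h] := leP G (M + e); have M0 := M_ge0.
(* If [G > M + e], then [a + (G - e) < 2 r] and [r^2 <= M a] contradict
   [(a + (G - e))^2 >= 4 a (G - e)]. *)
have {}h3 : 0 <= a + (G - e) < 2 * r by apply/andP; split; lra.
have : (a + (G - e)) ^+ 2 < (2 * r) ^+ 2.
  by case/andP: h3 => h3 h4; rewrite ltr_sqr ?nnegrE // (le_trans h3) // ltW.
have : 0 <= a * (G - e - M) by rewrite mulr_ge0 //; lra.
have := sqr_ge0 (a - (G - e)); nra.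
Qed.

End Riesz.

(** * Subspaces and orthogonal decompositions *)

Section Instances.
Variables (R : realType).

Section Ip.
Variable V : hilbertType R.
Implicit Types (x y z : V) (a : R[i]).

Lemma Re_ip x : Re (ip x x) = hn x ^+ 2.
Proof. by rewrite -ip_norm hnE -rmorphXn. Qed.

Lemma hn_lt_sqr x (e : R) : 0 < e -> (hn x ^+ 2 < e ^+ 2) = (hn x < e).
Proof. by move=> e0; rewrite ltr_sqr ?nnegrE ?hn_ge0 // ltW. Qed.

Lemma ip_complete (u : nat -> V) :
  (forall e : R, 0 < e -> exists N, forall m n, (N <= m)%N -> (N <= n)%N ->
     Re (ip (u m - u n) (u m - u n)) < e) ->
  exists l, forall e : R, 0 < e -> exists N, forall n, (N <= n)%N ->
     Re (ip (u n - l) (u n - l)) < e.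
Proof.
move=> h; have [|l /cvg_hn_seqP hl] := @complete_hn R V u.
  move=> e e0; have [|N hN] := h (e ^+ 2); first by rewrite exprn_gt0.
  by exists N => m n hm /(hN _ _ hm); rewrite Re_ip hn_lt_sqr.
exists l => e e0; have [|N hN] := hl (Num.sqrt e); first by rewrite sqrtr_gt0.
exists N => n /hN; rewrite Re_ip -(hn_lt_sqr _ _) ?sqrtr_gt0 //.
by rewrite sqr_sqrtr // ltW.
Qed.

Lemma ip_ge0 x : 0 <= Re (ip x x). Proof. by rewrite Re_ip sqr_ge0. Qed.

Definition hform_ip : hform V :=
  HForm (@ip_linearl R V) (@ip_conj R V) ip_ge0 ip_complete.

Lemma ip0l y : ip 0 y = 0 :> R[i]. Proof. exact: (hb0l hform_ip). Qed.
Lemma ip0r y : ip y 0 = 0 :> R[i]. Proof. exact: (hb0r hform_ip). Qed.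
Lemma ipDl x y z : ip (x + y) z = ip x z + ip y z.
Proof. exact: (hbDl hform_ip). Qed.
Lemma ipDr x y z : ip z (x + y) = ip z x + ip z y.
Proof. exact: (hbDr hform_ip). Qed.
Lemma ipBl x y z : ip (x - y) z = ip x z - ip y z.
Proof. exact: (hbBl hform_ip). Qed.
Lemma ipBr x y z : ip z (x - y) = ip z x - ip z y.
Proof. exact: (hbBr hform_ip). Qed.
Lemma ipNl x z : ip (- x) z = - ip x z. Proof. exact: (hbNl hform_ip). Qed.
Lemma ipNr x z : ip z (- x) = - ip z x. Proof. exact: (hbNr hform_ip). Qed.
Lemma ipZl a x z : ip (a *: x) z = a * ip x z.
Proof. exact: (hbZl hform_ip). Qed.
Lemma ipZr a x z : ip z (a *: x) = conjc a * ip z x.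
Proof. exact: (hbZr hform_ip). Qed.
Lemma Re_ipC x y : Re (ip x y) = Re (ip y x).
Proof. exact: (Re_hbC hform_ip). Qed.

Lemma Re_ip_le x y : Re (ip x y) <= hn x * hn y.
Proof.
have := cauchy_schwarz hform_ip x y; rewrite /= !Re_ip -exprMn.
move=> h; apply: le_trans (ler_norm _) _.
by rewrite -(ler_sqr) ?nnegrE ?mulr_ge0 ?hn_ge0 // real_normK ?num_real.
Qed.

Lemma ip_self_real x : ip x x = (hn x ^+ 2)%:C.
Proof. by rewrite -ip_norm hnE -rmorphXn. Qed.

Lemma ip_eq0 x : Re (ip x x) <= 0 -> x = 0.
Proof.
rewrite Re_ip => h; apply: hn_eq0; apply/eqP; rewrite -sqrf_eq0 eq_le h.
exact: sqr_ge0.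
Qed.

Lemma ip_inj x y : (forall z, ip x z = ip y z) -> x = y.
Proof.
move=> h; apply/eqP; rewrite -subr_eq0; apply/eqP/ip_eq0.
by rewrite ipBl h subrr.
Qed.

End Ip.

Section Sum.
Variables (E F : lmodType R[i]) (b : hform E) (c : hform F) (k : R).
Hypothesis k0 : 0 < k.

(** The weight is twice the real part of the parameter for Cayley transforms, and 1 for graphs. *)
Let s (p q : E * F) : R[i] := b p.1 q.1 + k%:C * c p.2 q.2.

Let s_linear a x y z : s (a *: x + y) z = a * s x z + s y z.
Proof. by rewrite /s /= !hb_linear; ring. Qed.
Let s_conj x y : s y x = conjc (s x y).
Proof. by rewrite /s conjcD conjcM conjc_realE -!hb_conj. Qed.
Let s_re x : Re (s x x) = Re (b x.1 x.1) + k * Re (c x.2 x.2).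
Proof. by rewrite /s ReD ReZ. Qed.
Let s_ge0 x : 0 <= Re (s x x).
Proof. by rewrite s_re addr_ge0 ?mulr_ge0 ?hb_ge0 // ltW. Qed.
Let s_complete (u : nat -> E * F) :
  (forall e : R, 0 < e -> exists N, forall m n, (N <= m)%N -> (N <= n)%N ->
     Re (s (u m - u n) (u m - u n)) < e) ->
  exists l, forall e : R, 0 < e -> exists N, forall n, (N <= n)%N ->
     Re (s (u n - l) (u n - l)) < e.
Proof.
have kp := k0; move=> h; have [|l1 h1] := @hb_complete _ _ b (fun n => (u n).1).
  move=> e /h[N hN]; exists N => m n hm /(hN _ _ hm); apply: le_lt_trans.
  by rewrite s_re lerDl mulr_ge0 ?hb_ge0 // ltW.
have [|l2 h2] := @hb_complete _ _ c (fun n => (u n).2).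
  move=> e e0; have /h[N hN] : 0 < k * e by rewrite mulr_gt0.
  exists N => m n hm /(hN _ _ hm); rewrite s_re /=.
  rewrite -(ltr_pM2l k0 (Re (c _ _))); apply: le_lt_trans.
  by rewrite lerDr hb_ge0.
exists (l1, l2) => e e0; have [|N hN] := h1 (e / 2); first by lra.
have [|N' hN'] := h2 (e / 2 / k); first by rewrite !divr_gt0.
exists (maxn N N') => n; rewrite geq_max => /andP[/hN g /hN' g'].
rewrite s_re /= [ltRHS]splitr ltrD //.
by rewrite mulrC -ltr_pdivlMr.
Qed.

Definition hform_sum : hform (E * F)%type := HForm s_linear s_conj s_ge0 s_complete.

Lemma hform_sumE p q : hform_sum p q = b p.1 q.1 + k%:C * c p.2 q.2.
Proof. by []. Qed.
End Sum.
End Instances.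

Section Subspaces.
Variables (R : realType) (E : lmodType R[i]).

Definition subspace (M : set E) : Prop :=
  M 0 /\ forall a x y, M x -> M y -> M (a *: x + y).

Lemma subspaceD M x y : subspace M -> M x -> M y -> M (x + y).
Proof. by move=> [_ h] Mx My; rewrite -(scale1r x); exact: h. Qed.
Lemma subspaceZ M a x : subspace M -> M x -> M (a *: x).
Proof. by move=> [h0 h] Mx; rewrite -(addr0 (_ *: _)); exact: h. Qed.
Lemma subspaceB M x y : subspace M -> M x -> M y -> M (x - y).
Proof. by move=> hM Mx My; rewrite -scaleN1r addrC; apply: hM.2. Qed.

Definition lspan (G : set E) : set E :=
  [set x | forall M, subspace M -> G `<=` M -> M x].

Lemma lspan_subspace G : subspace (lspan G).
Proof.
split=> [M []//|a x y hx hy M hM GM].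
by apply: hM.2; [exact: hx|exact: hy].
Qed.
Lemma sub_lspan G : G `<=` lspan G.
Proof. by move=> x Gx M _; exact. Qed.

Lemma lspan_form0 (B : E -> E -> R[i]) (G : set E) :
  (forall a x y z, B (a *: x + y) z = a * B x z + B y z) ->
  (forall a x y z, B z (a *: x + y) = conjc a * B z x + B z y) ->
  (forall x y, G x -> G y -> B x y = 0) ->
  forall x y, lspan G x -> lspan G y -> B x y = 0.
Proof.
move=> Bl Br BG x y hx; have B0l z : B 0 z = 0.
  by have := Bl (-1) 0 0 z; rewrite scaler0 addr0 mulN1r addNr.
have B0r z : B z 0 = 0.
  have := Br (-1) 0 0 z; rewrite scaler0 addr0 rmorphN rmorph1 /= mulN1r addNr.
  by [].
move=> hy; apply: (hy [set y | B x y = 0]).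
  by split=> [|a u v /= hu hv] /=; rewrite ?Br ?hu ?hv ?mulr0 ?addr0.
move=> {hy} y Gy /=; apply: (hx [set x | B x y = 0]); last by move=> ? /BG; exact.
by split=> [|a u v /= hu hv] /=; rewrite ?Bl ?hu ?hv ?mulr0 ?addr0.
Qed.

Lemma polarization0 (B : E -> E -> R[i]) (M : set E) : subspace M ->
  (forall a x y z, B (a *: x + y) z = a * B x z + B y z) ->
  (forall a x y z, B z (a *: x + y) = conjc a * B z x + B z y) ->
  (forall x, M x -> B x x = 0) ->
  forall x y, M x -> M y -> B x y = 0.
Proof.
move=> hM Bl Br BM x y Mx My.
have h a : a * B x y + conjc a * B y x = 0.
  have := BM _ (hM.2 a _ _ Mx My); rewrite Bl !Br !BM // mulr0 add0r addr0.
  by [].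
have h1 := h 1; have h2 := h 'i.
rewrite rmorph1 !mul1r in h1.
have ci : conjc 'i = - 'i :> R[i] by apply/eqP; rewrite eq_complex /= !oppr0 !eqxx.
rewrite ci mulNr -mulrBr in h2.
move/eqP: h2; rewrite mulf_eq0 complexiE (negbTE (neq0Ci _)) subr_eq0 => /eqP h2.
by move: h1; rewrite -h2 => /eqP; rewrite -mulr2n -mulr_natl mulf_eq0 pnatr_eq0 => /eqP.
Qed.

(** [g] is a projection of [x] on the closure of [M]; as [M] need not be closed, membership is
    expressed by approximation. *)
Lemma orthogonal_decomposition (b : hform E) (M : set E) (x : E) : subspace M ->
  exists2 g, forall d, M d -> b d (x - g) = 0 &
    forall e : R, 0 < e -> exists2 d, M d & Re (b (d - g) (d - g)) < e.
Proof.
move=> hM; pose L d c := M d /\ c = b d x.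
have [|a d c d' c' [Md ->] [Md' ->]|d c [_ ->]||g [gL _ cl]] :=
    @riesz R E b L (Re (b x x)).
- by split; [exact: hM.1|rewrite hb0l].
- by split; [exact: hM.2|rewrite hb_linear].
- by rewrite mulrC; exact: cauchy_schwarz.
- exact: hb_ge0.
exists g => [d Md|e /cl[d [c [[Md _] h]]]]; last by exists d.
by rewrite hbBr -(gL d _ (conj Md erefl)) subrr.
Qed.

(** With [g] the projection on the closure of [M], the vector [x - g] annihilates [M]. So it is
    orthogonal to [x] by hypothesis and to [g] by approximation, hence to itself. *)
Lemma bi_annihilator (b : hform E) (M : set E) (x : E) : subspace M ->
  (forall g, (forall d, M d -> b d g = 0) -> b x g = 0) ->
  forall e : R, 0 < e -> exists2 d, M d & Re (b (d - x) (d - x)) < e.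
Proof.
move=> hM h; have [g gM cl] := orthogonal_decomposition b x hM.
have bx0 : b x (x - g) = 0 by exact: h.
have q0 : Re (b (x - g) (x - g)) = 0.
  rewrite hbBl bx0 sub0r ReN; apply/eqP; rewrite oppr_eq0 -sqrf_eq0 eq_le sqr_ge0 andbT.
  apply: le0_eps => e e0.
  pose Q := Re (b (x - g) (x - g)); have Q0 : 0 <= Q by rewrite hb_ge0.
  have [|d Md hd] := cl (e / (Q + 1)); first by rewrite divr_gt0 //; lra.
  have -> : b g (x - g) = - b (d - g) (x - g) by rewrite hbBl (gM d Md) sub0r opprK.
  rewrite ReN sqrrN; apply: le_trans (cauchy_schwarz _ _ _) _; rewrite -/Q.
  have -> : e = e / (Q + 1) * (Q + 1) by rewrite divfK // gt_eqF //; lra.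
  by apply: ler_pM; rewrite ?hb_ge0 ?(ltW hd) //; lra.
move=> e e0; have [|d Md hd] := cl (e / 2); first by rewrite divr_gt0.
exists d => //; have -> : d - x = (d - g) + (g - x) by rewrite addrA subrK.
by apply: le_lt_trans (Re_hbD2 _ _ _) _; rewrite (Re_hbBC _ g) q0; lra.
Qed.

End Subspaces.

(** * Adjoints, annihilators and unitary maps *)

Definition linear_pack (R : realType) (V W : lmodType R[i]) (f : V -> W)
    (f_linear : linear f) : {linear V -> W} :=
  HB.pack f (GRing.isLinear.Build _ _ _ _ f f_linear).

Section HilbertTheory.
Variables (R : realType).

Section One.
Variables (V W : hilbertType R).

Lemma adjP (T : {linear V -> W}) (K : R) :
  (forall x, hn (T x) <= K * hn x) ->
  forall x w, ip (T x) w = ip x (adj T w).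
Proof.
move=> TK x w; rewrite /adj; case: xgetP => [v _ ->//|/(_ _)/= nex].
have [|a d c d' c' -> ->|d c ->||g [gL _ _]] :=
    @riesz R V (hform_ip V) (fun d c => c = ip (T d) w) (K ^+ 2 * hn w ^+ 2).
- by rewrite linear0 ip0l.
- by rewrite linearP ipDl ipZl.
- apply: le_trans (cauchy_schwarz (hform_ip W) _ _) _.
  rewrite /= !Re_ip [leRHS]mulrAC. rewrite ler_wpM2r ?sqr_ge0 // -exprMn.
  have h := le_trans (hn_ge0 _) (TK d).
  by rewrite ler_sqr ?nnegrE ?hn_ge0.
- by rewrite mulr_ge0 ?sqr_ge0.
by case: (nex g) => z; rewrite (gL z _ erefl).
Qed.

Lemma orthogonal_dense (M : set V) : subspace M ->
  (forall g, (forall d, M d -> ip d g = 0) -> g = 0) ->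
  forall x (e : R), 0 < e -> exists2 d, M d & hn (x - d) < e.
Proof.
move=> hM h x e e0; have [||d Md hd] :=
    @bi_annihilator R V (hform_ip V) M x hM _ (e ^+ 2).
- by move=> g /= /h ->; rewrite ip0r.
- by rewrite exprn_gt0.
- by exists d => //; rewrite hnBC -hn_lt_sqr // -Re_ip.
Qed.

Definition annihilator (G : set V) : set V := [set x | forall g, G g -> ip x g = 0].

Lemma annihilator_subspace G : subspace (annihilator G).
Proof.
split=> [g _|a x y hx hy g Gg]; first exact: ip0l.
by rewrite ipDl ipZl hx // hy // mulr0 addr0.
Qed.

Lemma annihilator_closed G x :
  (forall e : R, 0 < e -> exists2 d, annihilator G d & hn (d - x) < e) ->
  annihilator G x.
Proof.
move=> h g Gg.
(* One-sided bounds for all multiples suffice: 1, -1, ['i] and [- 'i] give both parts of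
   [ip x g]. *)
have R0 (a : R[i]) : Re (a * ip x g) <= 0.
  apply: le0_eps => e e0; have hg := hn_ge0 g; have ha := Re_norm_ge0 a.
  pose K := Re `|a| * hn g + 1; have K0 : 0 < K by rewrite ltr_wpDl // mulr_ge0.
  have [|d Gd hd] := h (e / K); first by rewrite divr_gt0.
  have -> : a * ip x g = ip (a *: (x - d)) g by rewrite ipZl ipBl (Gd g Gg) subr0.
  apply: le_trans (Re_ip_le _ _) _; rewrite hnZ hnBC.
  have -> : e = K * (e / K) by rewrite mulrC divfK // gt_eqF.
  apply: (@le_trans _ _ ((Re `|a| * hn g) * (e / K))).
    by rewrite mulrAC ler_wpM2l ?mulr_ge0 // ltW.
  by rewrite ler_wpM2r ?ltW ?divr_gt0 // /K; lra.
apply: complex_eqP => /=.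
  have := R0 1; have := R0 (-1); rewrite mulN1r mul1r ReN => h1 h2.
  by apply/le_anti; rewrite h2 -oppr_le0.
have := R0 'i; have := R0 (- 'i); rewrite mulNr ReN Rei opprK => h1 h2.
by apply/le_anti; rewrite h1 -oppr_le0.
Qed.

Lemma annihilator_projection (G : set V) (x : V) :
  exists2 n, annihilator G n & forall d, annihilator G d -> ip d (x - n) = 0.
Proof.
have [n hn1 hn2] :=
  orthogonal_decomposition (hform_ip V) x (annihilator_subspace G).
exists n => //; apply: annihilator_closed => e e0.
have [|d Gd hd] := hn2 (e ^+ 2); first by rewrite exprn_gt0.
by exists d => //; rewrite -hn_lt_sqr // -Re_ip.
Qed.

End One.

(** [g] is the image of [f] under the partial isometry sending [p.1] to [p.2]. It represents the
    functional taking [p.2] to [ip p.1 f], which equality of the Gram matrices makes bounded. *)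
Lemma gram_transfer (V W : hilbertType R) (G : set (V * W)) :
  (forall p q, G p -> G q -> ip p.1 q.1 = ip p.2 q.2) ->
  forall f : V, exists2 g : W, forall p, G p -> ip p.2 g = ip p.1 f & hn g <= hn f.
Proof.
move=> gram f.
have gramS p : lspan G p -> ip p.1 p.1 = ip p.2 p.2.
  move=> hp; apply/eqP; rewrite -subr_eq0; apply/eqP.
  apply: (@lspan_form0 _ _ (fun p q => ip p.1 q.1 - ip p.2 q.2) G _ _ _ p p) => //.
  - by move=> a x y z /=; rewrite !ipDl !ipZl; ring.
  - by move=> a x y z /=; rewrite !ipDr !ipZr; ring.
  - by move=> x y Gx Gy /=; rewrite gram // subrr.
have [|a d c d' c' [p hp [-> ->]] [q hq [-> ->]]|d c [p hp [-> ->]]||g [gL gf _]] :=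
    @riesz R W (hform_ip W) (fun d c => exists2 p, lspan G p & d = p.2 /\ c = ip p.1 f)
      (hn f ^+ 2).
- by exists 0; [case: (lspan_subspace G)|rewrite ip0l].
- exists (a *: p + q); first exact: (lspan_subspace G).2.
  by rewrite /= ipDl ipZl.
- apply: le_trans (cauchy_schwarz (hform_ip V) _ _) _.
  by rewrite mulrC /= Re_ip gramS.
- by rewrite sqr_ge0.
exists g => [p Gp|].
  by symmetry; apply: gL; exists p => //; exact: sub_lspan.
by rewrite -ler_sqr ?nnegrE ?hn_ge0 // -Re_ip.
Qed.

(** [gram_transfer] in both directions gives two contractions; totality makes them mutually inverse
    and linear, so each preserves norms. *)
Lemma unitary_of_gram (V W : hilbertType R) (G : set (V * W)) :
  (forall p q, G p -> G q -> ip p.1 q.1 = ip p.2 q.2) ->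
  (forall x : V, (forall p, G p -> ip p.1 x = 0) -> x = 0) ->
  (forall y : W, (forall p, G p -> ip p.2 y = 0) -> y = 0) ->
  exists2 D : {linear V -> W}, unitary D & forall p, G p -> D p.1 = p.2.
Proof.
move=> gram tot1 tot2.
have eq1 (x y : V) : (forall p, G p -> ip p.1 x = ip p.1 y) -> x = y.
  move=> h; apply/eqP; rewrite -subr_eq0; apply/eqP/tot1 => p Gp.
  by rewrite ipBr h // subrr.
have eq2 (x y : W) : (forall p, G p -> ip p.2 x = ip p.2 y) -> x = y.
  move=> h; apply/eqP; rewrite -subr_eq0; apply/eqP/tot2 => p Gp.
  by rewrite ipBr h // subrr.
have /choice[D hD] : forall f : V, exists g : W,
    (forall p, G p -> ip p.2 g = ip p.1 f) /\ hn g <= hn f.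
  by move=> f; have [g h1 h2] := gram_transfer gram f; exists g.
have /choice[D' hD'] : forall g : W, exists f : V,
    (forall p, G p -> ip p.1 f = ip p.2 g) /\ hn f <= hn g.
  move=> g; have [|f h1 h2] := @gram_transfer W V [set p | G (p.2, p.1)] _ g.
    by move=> p q Gp Gq; rewrite (gram (p.2, p.1) (q.2, q.1)).
  by exists f; split=> // p Gp; rewrite (h1 (p.2, p.1)) //=; case: p Gp.
have DK : cancel D D'.
  by move=> x; apply: eq1 => p Gp; rewrite (hD' _).1 // (hD _).1.
have DK' : cancel D' D.
  by move=> x; apply: eq2 => p Gp; rewrite (hD _).1 // (hD' _).1.
have D_lin : linear D.
  move=> a x y; apply: eq2 => p Gp.
  by rewrite ipDr ipZr !(hD _).1 // ipDr ipZr.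
have Dhn x : hn (D x) = hn x.
  by apply/le_anti; rewrite (hD x).2 /= -{1}(DK x) (hD' _).2.
exists (linear_pack D_lin) => [|p Gp /=]; last first.
  by apply: eq2 => q Gq; rewrite (hD _).1 // gram.
split=> [|x y /=]; first by exists D'.
apply/eqP; rewrite -subr_eq0; apply/eqP.
apply: (@polarization0 _ V (fun x y => ip (D x) (D y) - ip x y) setT) => //.
- by move=> a u v z; rewrite D_lin !ipDl !ipZl; ring.
- by move=> a u v z; rewrite D_lin !ipDr !ipZr; ring.
- by move=> z _; rewrite !ip_self_real Dhn subrr.
Qed.

End HilbertTheory.

(* Linear identities between vectors are tested against an arbitrary vector. *)
Ltac ip_expand := apply: ip_inj => ?; rewrite ?(ipDl, ipBl, ipNl, ipZl, ip0l).
Ltac hilbert_ring := ip_expand; ring.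

(** * Dissipative operators and contraction semigroups *)

Lemma lim_hn_le (R : realType) (V : normedModType R[i]) (u : nat -> V) l c (B : R) :
  u @ \oo --> l ->
  (forall e : R, 0 < e -> exists N, forall n, (N <= n)%N -> hn (u n - c) <= B + e) ->
  hn (l - c) <= B.
Proof.
move=> /cvg_hn_seqP ul h; rewrite -subr_le0; apply: le0_eps => e e0.
have [|N hN] := ul (e / 2); first by lra.
have [|N' hN'] := h (e / 2); first by lra.
have := hN _ (leq_maxl N N'); have := hN' _ (leq_maxr N N').
by have := hn_tri (u (maxn N N')) l c; rewrite (hnBC l (u _)); lra.
Qed.

(** Rounding times to a dyadic grid breaks additivity by at most one step, which vanishes in the
    limit. *)
Lemma truncn_addP (R : realType) (x y : R) : 0 <= x -> 0 <= y ->
  Num.truncn (x + y) = (Num.truncn x + Num.truncn y)%N \/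
  Num.truncn (x + y) = (Num.truncn x + Num.truncn y).+1.
Proof.
move=> x0 y0.
have /andP[hx hx'] := truncn_itv x0; have /andP[hy hy'] := truncn_itv y0.
have /andP[h h'] := truncn_itv (addr_ge0 x0 y0).
set m := Num.truncn x in hx hx' *; set n := Num.truncn y in hy hy' *.
set p := Num.truncn _ in h h' *.
have : (m + n < p.+1)%N.
  by rewrite -(ltr_nat R) natrD; apply: le_lt_trans h'; exact: lerD.
have : (p < m.+1 + n.+1)%N.
  by rewrite -(ltr_nat R) natrD; apply: le_lt_trans h _; exact: ltrD.
rewrite addSn addnS !ltnS leq_eqVlt => /orP[/eqP ->|]; first by right.
by rewrite ltnS => h1 h2; left; apply/eqP; rewrite eqn_leq h1 h2.
Qed.

Section LumerPhillips.
Variables (R : realType) (H : hilbertType R) (A : set (H * H)).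
Hypothesis A_sub : subspace A.
Hypothesis A_fun : forall z, A (0, z) -> z = 0.
Hypothesis A_diss : forall x z, A (x, z) -> Re (ip z x) <= 0.
Hypothesis A_range : forall r : R, 0 < r -> forall f, exists x z,
  A (x, z) /\ r%:C *: x - z = f.

Let A_pair a x z x' z' : A (x, z) -> A (x', z') -> A (a *: x + x', a *: z + z').
Proof. exact: A_sub.2. Qed.

Lemma dissipative_le (h : R) x z : 0 <= h -> A (x, z) ->
  hn x <= hn (x - h%:C *: z).
Proof.
move=> h0 Axz; have [->|x0] := eqVneq x 0; first by rewrite hn0 hn_ge0.
have xp : 0 < hn x.
  by rewrite lt_neqAle hn_ge0 andbT eq_sym; apply: contraNneq x0 => /hn_eq0 ->.
rewrite -(ler_pM2r xp); apply: le_trans (Re_ip_le _ _).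
rewrite ipBl ReB ipZl ReZ Re_ip; have := A_diss Axz; nra.
Qed.

(** Write a vector [g] orthogonal to the domain as [y - z] with [(y, z)] in [A]. Orthogonality to
    [y] and dissipativity give [y = 0], and then [z = 0] by [A_fun]. *)
Lemma dissipative_domain_dense x (e : R) : 0 < e ->
  exists x' z', A (x', z') /\ hn (x - x') < e.
Proof.
move=> e0; have [||x' [z' Az] h] :=
  @orthogonal_dense R H [set x | exists z, A (x, z)] _ _ x e e0; last first.
- by exists x', z'.
- move=> g gM; have [y [z [Ayz yz]]] := A_range ltr01 g.
  rewrite scale1r in yz; have y0 : y = 0.
    apply: ip_eq0; have := gM y (ex_intro _ z Ayz).
    rewrite -yz ipBr => /eqP; rewrite subr_eq0 => /eqP ->.
    by rewrite Re_ipC; exact: A_diss Ayz.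
  by move: Ayz; rewrite -yz y0 => /A_fun ->; rewrite subr0.
split; first by exists 0; exact: A_sub.1.
by move=> a u v [z Az] [z' Az']; exists (a *: z + z'); exact: A_pair.
Qed.

(** The condition on [h] stands under the quantifier so that choice yields a total function, equal
    to [(1 - h A)^-1] for [0 < h]. *)
Lemma backward_Euler_exists (h : R) f : exists x, 0 < h -> A (x, h^-1%:C *: (x - f)).
Proof.
have [h0|h0] := ltP 0 h; last by exists 0 => h1; exfalso; lra.
have h1 : 0 < h^-1 by rewrite invr_gt0.
have [x [z [Axz xz]]] := A_range h1 (h^-1%:C *: f).
by exists x => _; rewrite scalerBr -xz opprB addrC subrK.
Qed.

Definition Euler (h : R) (f : H) : H := sval (cid (backward_Euler_exists h f)).

Section Step.
Variable h : R.
Hypothesis h0 : 0 < h.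
Local Notation J := (Euler h).

Let hK (v : H) : h%:C *: (h^-1%:C *: v) = v.
Proof. by rewrite scalerA -rmorphM divff ?gt_eqF // scale1r. Qed.

Lemma EulerP f : A (J f, h^-1%:C *: (J f - f)).
Proof. by rewrite /Euler; case: cid => x /= /(_ h0). Qed.

Lemma Euler_uniq x z : A (x, z) -> J (x - h%:C *: z) = x.
Proof.
move=> Axz; set f := x - _; apply/eqP; rewrite -subr_eq0; apply/eqP/hn_le0.
have := A_pair (-1) Axz (EulerP f) => /(dissipative_le (ltW h0)).
have -> : -1 *: x + J f - h%:C *: (-1 *: z + h^-1%:C *: (J f - f)) = 0.
  rewrite scalerDr hK /f; hilbert_ring.
by rewrite hn0 scaleN1r addrC.
Qed.

Lemma Euler_linear : linear J.
Proof.
move=> a x y; rewrite -[RHS](Euler_uniq (A_pair a (EulerP x) (EulerP y))).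
congr J; rewrite scalerDr [h%:C *: (a *: _)]scalerA [h%:C * a]mulrC -scalerA !hK.
hilbert_ring.
Qed.

Lemma Euler_contraction x : hn (J x) <= hn x.
Proof.
apply: le_trans (dissipative_le (ltW h0) (EulerP x)) _.
by rewrite hK subKr.
Qed.

Lemma EulerB x y : J (x - y) = J x - J y.
Proof.
by rewrite -[- y]scaleN1r [x + _]addrC Euler_linear scaleN1r addrC.
Qed.
Lemma EulerZ a x : J (a *: x) = a *: J x.
Proof.
have J0 : J 0 = 0 by have := EulerB 0 0; rewrite !subrr.
by have := Euler_linear a x 0; rewrite J0 !addr0.
Qed.

Lemma EulerE x z : A (x, z) -> J x = x + h%:C *: J z.
Proof. by move/Euler_uniq => {2}<-; rewrite EulerB EulerZ subrK. Qed.

Lemma Euler_domain x z : A (x, z) -> A (J x, J z).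
Proof.
move=> Axz; have := EulerP x; rewrite {2}(EulerE Axz) addrC addKr scalerA.
by rewrite -rmorphM mulVf ?gt_eqF // scale1r.
Qed.

Lemma iter_Euler_linear n : linear (iter n J).
Proof. by elim: n => // n IH a x y; rewrite !iterS IH Euler_linear. Qed.

Lemma iter_Euler_contraction n x : hn (iter n J x) <= hn x.
Proof.
by elim: n => // n IH; rewrite iterS; apply: le_trans IH; exact: Euler_contraction.
Qed.

Lemma iter_Euler_domain n x z : A (x, z) -> A (iter n J x, iter n J z).
Proof. by move=> Axz; elim: n => // n IH; rewrite !iterS; exact: Euler_domain. Qed.

Lemma iter_EulerB n x y : iter n J (x - y) = iter n J x - iter n J y.
Proof. by elim: n => // n IH; rewrite !iterS IH EulerB. Qed.

Lemma iter_Euler_dist n x z : A (x, z) -> hn (iter n J x - x) <= n%:R * h * hn z.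
Proof.
move=> Axz; elim: n => [|n IH]; first by rewrite subrr hn0 !mul0r.
apply: le_trans (hn_tri (iter n J x) _ _) _.
have -> : n.+1%:R * h * hn z = h * hn z + n%:R * h * hn z.
  by rewrite -natr1; ring.
apply: lerD => //; rewrite iterSr (EulerE Axz) -iter_EulerB addrC addKr.
apply: le_trans (iter_Euler_contraction _ _) _.
by rewrite hnZr ?ler_wpM2l ?Euler_contraction // ltW.
Qed.

(** First-order expansion, meant to identify the generator. As [z = A x] may lie outside the domain,
    it is approximated by some [z'] inside. *)
Lemma iter_Euler_taylor n x z z' w' : A (x, z) -> A (z', w') ->
  hn (iter n J x - x - (n%:R * h)%:C *: z) <=
  n%:R * h * (2 * hn (z - z') + n%:R * h * hn w').
Proof.
move=> Axz Azw; elim: n => [|n IH].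
  by rewrite !mul0r scale0r subr0 subrr hn0.
have -> : iter n.+1 J x - x - (n.+1%:R * h)%:C *: z =
   (iter n J x - x - (n%:R * h)%:C *: z) + h%:C *: (iter n.+1 J z - z).
  have -> : iter n.+1 J x = iter n J x + h%:C *: iter n.+1 J z.
    by rewrite iterSr (EulerE Axz) [x + _]addrC iter_Euler_linear -iterSr addrC.
  by rewrite -natr1 mulrDl mul1r rmorphD /=; hilbert_ring.
apply: le_trans (hnD _ _) _; apply: le_trans (lerD IH _) (_ : _ + h *
    (2 * hn (z - z') + n.+1%:R * h * hn w') <= _).
  rewrite hnZr ?(ltW h0) // ler_pM2l //.
  have -> : iter n.+1 J z - z = iter n.+1 J (z - z') + (iter n.+1 J z' - z') - (z - z').
    by rewrite iter_EulerB; hilbert_ring.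
  have := hnB (iter n.+1 J (z - z') + (iter n.+1 J z' - z')) (z - z').
  have := hnD (iter n.+1 J (z - z')) (iter n.+1 J z' - z').
  have := iter_Euler_contraction n.+1 (z - z').
  by have := iter_Euler_dist n.+1 Azw; lra.
rewrite -natr1; have := hn_ge0 w'; have := ler0n R n; have := h0.
set N := n%:R; set W := hn w'; set P := hn _ => hp N0 W0.
have : 0 <= N * (h * (h * W)) by rewrite !mulr_ge0 // ltW.
nra.
Qed.

End Step.

(** The terms of order 0 and 1 cancel; the rest is at most [(1 + 1/2 + 1/4) h^2 |w|], and 2 rounds
    the sum up. *)
Lemma Euler_halve (h : R) x z w : 0 < h -> A (x, z) -> A (z, w) ->
  hn (Euler h x - iter 2 (Euler (h / 2)) x) <= 2 * h ^+ 2 * hn w.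
Proof.
move=> h0 Axz Azw; have k0 : 0 < h / 2 by lra.
rewrite /= (EulerE k0 (Euler_domain k0 Axz)) (EulerE k0 (Euler_domain k0 Azw)).
rewrite (EulerE k0 Axz) (EulerE h0 Axz) (EulerE k0 Azw) (EulerE h0 Azw).
set Jw := Euler h w; set Kw := Euler _ w; set KKw := Euler _ Kw.
have -> : x + h%:C *: (z + h%:C *: Jw) -
   (x + (h / 2)%:C *: (z + (h / 2)%:C *: Kw) +
    (h / 2)%:C *: (z + (h / 2)%:C *: Kw + (h / 2)%:C *: KKw)) =
  (h ^+ 2)%:C *: Jw - ((h ^+ 2 / 2)%:C *: Kw + (h ^+ 2 / 4)%:C *: KKw).
  have nC n : n%:R = (n%:R : R)%:C :> R[i] by rewrite rmorph_nat.
  have -> : h%:C = 2 * (h / 2)%:C :> R[i].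
    by rewrite nC -rmorphM /=; congr (_%:C); field.
  have -> : (h ^+ 2)%:C = 4 * (h / 2)%:C ^+ 2 :> R[i].
    by rewrite nC -rmorphXn -rmorphM /=; congr (_%:C); field.
  have -> : (h ^+ 2 / 2)%:C = 2 * (h / 2)%:C ^+ 2 :> R[i].
    by rewrite nC -rmorphXn -rmorphM /=; congr (_%:C); field.
  have -> : (h ^+ 2 / 4)%:C = (h / 2)%:C ^+ 2 :> R[i].
    by rewrite -rmorphXn /=; congr (_%:C); field.
  by hilbert_ring.
apply: le_trans (hnB _ _) _; have := hnD ((h ^+ 2 / 2)%:C *: Kw) ((h ^+ 2 / 4)%:C *: KKw).
have hw := hn_ge0 w; have hh := sqr_ge0 h.
have : hn Jw <= hn w by exact: Euler_contraction.
have h1 : hn Kw <= hn w by exact: Euler_contraction.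
have : hn KKw <= hn w by apply: le_trans h1; exact: Euler_contraction.
rewrite !hnZr ?divr_ge0 //; nra.
Qed.

(** Contractivity lets the local errors add up. The separate bound [W] survives the induction, where
    [w] is replaced by an iterate of smaller norm. *)
Lemma iter_Euler_halve (h : R) n x z w W : 0 < h -> A (x, z) -> A (z, w) ->
  hn w <= W ->
  hn (iter n (Euler h) x - iter n.*2 (Euler (h / 2)) x) <=
    n%:R * (2 * h ^+ 2 * W).
Proof.
move=> h0; have k0 : 0 < h / 2 by lra.
elim: n x z w => [|n IH] x z w Axz Azw wW; first by rewrite subrr hn0 mul0r.
set K := Euler (h / 2).
have AK p q : A (p, q) -> A (iter 2 K p, iter 2 K q) by exact: iter_Euler_domain.
have -> : iter n.+1 (Euler h) x - iter n.+1.*2 K x =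
    iter n (Euler h) (Euler h x - iter 2 K x) +
    (iter n (Euler h) (iter 2 K x) - iter n.*2 K (iter 2 K x)).
  by rewrite doubleS -addn2 iterD -/(iter 2 K x) iterSr iter_EulerB // addrA subrK.
apply: le_trans (hnD _ _) _; rewrite -natr1 mulrDl mul1r addrC lerD //.
  apply: IH (AK _ _ Axz) (AK _ _ Azw) _.
  by apply: le_trans wW; exact: iter_Euler_contraction.
apply: le_trans (iter_Euler_contraction h0 _ _) _.
apply: le_trans (Euler_halve h0 Axz Azw) _.
by rewrite ler_wpM2l // mulr_ge0 ?sqr_ge0.
Qed.

Let mesh (k : nat) : R := (2 ^+ k)^-1.
Let mesh_gt0 k : 0 < mesh k. Proof. by rewrite invr_gt0 exprn_gt0. Qed.
Let meshS k : mesh k.+1 = mesh k / 2.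
Proof. by rewrite /mesh exprS invfM mulrC. Qed.
Let mesh_lt (e : R) : 0 < e -> exists N, forall n, (N <= n)%N -> mesh n < e.
Proof.
move=> e0; exists (Num.truncn e^-1) => n hn.
rewrite -[e]invrK ltf_pV2 ?posrE ?exprn_gt0 ?invr_gt0 //.
apply: lt_le_trans (truncnS_gt _) _.
rewrite -natrX ler_nat; apply: leq_ltn_trans hn _; exact: ltn_expl.
Qed.

Let steps k (t : R) := Num.truncn (`|t| * 2 ^+ k).
Let steps_le k t : (steps k t)%:R * mesh k <= `|t|.
Proof.
rewrite ler_pdivrMr ?exprn_gt0 //.
by have /andP[] := truncn_itv (mulr_ge0 (normr_ge0 t) (ltW (exprn_gt0 k (@ltr0Sn R 1)))).
Qed.
Let steps_ge k t : `|t| <= (steps k t)%:R * mesh k + mesh k.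
Proof.
rewrite -[X in _ + X]mul1r -mulrDl natr1 ler_pdivlMr ?exprn_gt0 //.
exact/ltW/truncnS_gt.
Qed.
Let steps0 k : steps k 0 = 0%N.
Proof. by rewrite /steps normr0 mul0r truncn0. Qed.
Let stepsS k t : steps k.+1 t = (steps k t).*2 \/ steps k.+1 t = (steps k t).*2.+1.
Proof.
rewrite /steps exprS mulrCA mulr_natl mulr2n -addnn.
by apply: truncn_addP; rewrite mulr_ge0 // exprn_ge0.
Qed.
Let stepsD k s t : 0 <= s -> 0 <= t ->
  steps k (s + t) = (steps k s + steps k t)%N \/
  steps k (s + t) = (steps k s + steps k t).+1.
Proof.
move=> s0 t0; rewrite /steps !ger0_norm ?addr_ge0 // mulrDl.
by apply: truncn_addP; rewrite mulr_ge0 // exprn_ge0.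
Qed.

Definition dyadic_Euler k t x := iter (steps k t) (Euler (mesh k)) x.
Local Notation E := dyadic_Euler.

Let E_linear k t : linear (E k t).
Proof. exact: iter_Euler_linear. Qed.
Let EB k t x y : E k t (x - y) = E k t x - E k t y.
Proof. exact: iter_EulerB. Qed.
Let E_contraction k t x : hn (E k t x) <= hn x.
Proof. exact: iter_Euler_contraction. Qed.

(** The first term is the cost of halving every step; the second pays for the extra step that the
    finer grid may have. *)
Let E_step k t x z w : A (x, z) -> A (z, w) ->
  hn (E k.+1 t x - E k t x) <= mesh k * (2 * `|t| * hn w + hn z).
Proof.
move=> Axz Azw; have m0 := mesh_gt0 k.
have h1 : hn (E k t x - iter (steps k t).*2 (Euler (mesh k.+1)) x) <=
    mesh k * (2 * `|t| * hn w).
  rewrite meshS; apply: le_trans (iter_Euler_halve _ m0 Axz Azw (lexx _)) _.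
  have := steps_le k t; have := hn_ge0 w.
  set N := _%:R => w0 Nt; have : 0 <= mesh k * hn w by rewrite mulr_ge0 // ltW.
  nra.
have h2 : hn (E k.+1 t x - iter (steps k t).*2 (Euler (mesh k.+1)) x) <=
    mesh k * hn z.
  rewrite /dyadic_Euler; case: (stepsS k t) => ->.
    by rewrite subrr hn0 mulr_ge0 ?hn_ge0 ?ltW.
  rewrite iterSr -iter_EulerB //; apply: le_trans (iter_Euler_contraction _ _ _) _ => //.
  apply: le_trans (iter_Euler_dist (mesh_gt0 k.+1) 1 Axz) _.
  by rewrite mul1r ler_wpM2r ?hn_ge0 // meshS; lra.
apply: le_trans (hn_tri (iter (steps k t).*2 (Euler (mesh k.+1)) x) _ _) _.
by rewrite (hnBC _ (E k t x)); lra.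
Qed.

(** Summing [E_step] telescopes, since [mesh k] is [2 * (mesh k - mesh k.+1)]. *)
Let E_cauchy k m t x z w : A (x, z) -> A (z, w) ->
  hn (E (k + m) t x - E k t x) <=
    2 * (mesh k - mesh (k + m)) * (2 * `|t| * hn w + hn z).
Proof.
move=> Axz Azw; elim: m => [|m IH].
  by rewrite addn0 !subrr hn0 mulr0 mul0r.
apply: le_trans (hn_tri (E (k + m) t x) _ _) _.
have := E_step (k + m) t Axz Azw; rewrite addnS meshS; lra.
Qed.

(** A backward Euler step with small [h] moves a domain element into the domain of the square of
    [A]. *)
Let domain2_dense x (e : R) : 0 < e ->
  exists x' z w, [/\ A (x', z), A (z, w) & hn (x - x') < e].
Proof.
move=> e0; have [|x' [z [Axz hx]]] := @dissipative_domain_dense x (e / 2).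
  lra.
pose h := e / 2 / (hn z + 1); have z0 := hn_ge0 z.
have h0 : 0 < h by rewrite divr_gt0 //; lra.
exists (Euler h x'), (Euler h z), (h^-1%:C *: (Euler h z - z)).
split; [exact: Euler_domain|exact: EulerP|].
apply: le_lt_trans (hn_tri x' _ _) _; rewrite [ltRHS]splitr.
apply: ltr_leD => //; rewrite hnBC.
apply: le_trans (iter_Euler_dist h0 1 Axz) _.
rewrite mul1r /h mulrAC ler_pdivrMr; last by lra.
by rewrite ler_wpM2l; lra.
Qed.

Let E_cvg t x : exists l : H, E k t x @[k --> \oo] --> l.
Proof.
apply: complete_hn => e e0.
have [|x' [z [w [Axz Azw hx]]]] := @domain2_dense x (e / 4); first lra.
pose C := 2 * `|t| * hn w + hn z.
have C0 : 0 <= C by rewrite addr_ge0 ?mulr_ge0 ?hn_ge0.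
have [|N hN] := @mesh_lt (e / (8 * (C + 1))).
  by rewrite divr_gt0 //; lra.
exists N => m n hm hn'.
have hE k : (N <= k)%N -> hn (E k t x' - E N t x') <= e / 4.
  move=> /subnKC <-; apply: le_trans (E_cauchy N _ t Axz Azw) _; rewrite -/C.
  have := hN N (leqnn N); rewrite ltr_pdivlMr; last by lra.
  have := mesh_gt0 (N + (k - N)); have := mesh_gt0 N.
  set a := mesh N; set b := mesh _ => a0 b0; nra.
have hE' k : hn (E k t x - E k t x') < e / 4.
  by rewrite -EB; apply: le_lt_trans (E_contraction _ _ _) hx.
have := hE _ hm; have := hE _ hn'; have := hE' m; have := hE' n.
have := hn_tri (E m t x') (E m t x) (E n t x).
have := hn_tri (E N t x') (E m t x') (E n t x).
have := hn_tri (E n t x') (E N t x') (E n t x).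
rewrite (hnBC (E N t x') (E n t x')) (hnBC (E n t x') (E n t x)); lra.
Qed.


Definition semigroup_fun t x : H := sval (cid (E_cvg t x)).
Local Notation T := semigroup_fun.

Let T_cvg t x : E k t x @[k --> \oo] --> T t x.
Proof. exact: (svalP (cid (E_cvg t x))). Qed.

Let T_contraction t x : hn (T t x) <= hn x.
Proof.
rewrite -[T t x]subr0; apply: lim_hn_le (@T_cvg t x) _ => e e0; exists 0%N => n _.
by rewrite subr0; have := E_contraction n t x; lra.
Qed.

Let T_linear t : linear (T t).
Proof.
move=> a x y; apply/eqP; rewrite -subr_eq0; apply/eqP/hn_le0.
apply: lim_hn_le (@T_cvg t _) _ => e e0; rewrite add0r.
have a0 := Re_norm_ge0 a.
have [|N hN] := (cvg_hn_seqP _ _).1 (@T_cvg t x) (e / 2 / (Re `|a| + 1)).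
  by rewrite !divr_gt0 //; lra.
have [|N' hN'] := (cvg_hn_seqP _ _).1 (@T_cvg t y) (e / 2); first by lra.
exists (maxn N N') => n; rewrite geq_max => /andP[/hN hx /hN' hy].
rewrite E_linear.
have -> : a *: E n t x + E n t y - (a *: T t x + T t y) =
  a *: (E n t x - T t x) + (E n t y - T t y) by hilbert_ring.
apply: le_trans (hnD _ _) _; rewrite hnZ.
move: hx; rewrite ltr_pdivlMr; last by lra.
have := hn_ge0 (E n t x - T t x); nra.
Qed.

Let TB t x y : T t (x - y) = T t x - T t y.
Proof. by rewrite -[- y]scaleN1r [x + _]addrC T_linear scaleN1r addrC. Qed.

Let T_taylor t x z z' w' : 0 <= t -> A (x, z) -> A (z', w') ->
  hn (T t x - (x + t%:C *: z)) <= t * (2 * hn (z - z') + t * hn w').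
Proof.
move=> t0 Axz Azw; apply: lim_hn_le (@T_cvg t x) _ => e e0.
have z0 := hn_ge0 z; have [|N hN] := @mesh_lt (e / (hn z + 1)).
  by rewrite divr_gt0 //; lra.
exists N => n /hN; rewrite ltr_pdivlMr; last by lra.
have := steps_le n t; have := steps_ge n t; rewrite ger0_norm //.
have : 0 <= (steps n t)%:R * mesh n by rewrite mulr_ge0 ?ler0n // ltW.
have := iter_Euler_taylor (mesh_gt0 n) (steps n t) Axz Azw.
set s := _%:R * _ => h1 s0 h2 h3 h4.
have -> : E n t x - (x + t%:C *: z) =
    E n t x - x - s%:C *: z - (t - s)%:C *: z by rewrite rmorphB /=; hilbert_ring.
apply: le_trans (hnB _ _) _; rewrite hnZr ?subr_ge0 //.
apply: le_trans (lerD h1 (lexx _)) _.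
have z1 := hn_ge0 (z - z'); have w0 := hn_ge0 w'.
apply: lerD.
  apply: ler_pM => //; first by apply: addr_ge0; apply: mulr_ge0.
  by rewrite lerD2l ler_wpM2r.
by have := mesh_gt0 n; nra.
Qed.

Let T_dist t x z : 0 <= t -> A (x, z) -> hn (T t x - x) <= t * hn z.
Proof.
move=> t0 Axz; apply: lim_hn_le (@T_cvg t x) _ => e e0; exists 0%N => n _.
apply: le_trans (iter_Euler_dist (mesh_gt0 n) _ Axz) _.
by have := steps_le n t; have := hn_ge0 z; rewrite ger0_norm //; nra.
Qed.

Let T0 x : T 0 x = x.
Proof.
apply/eqP; rewrite -subr_eq0; apply/eqP/hn_le0.
apply: lim_hn_le (@T_cvg 0 x) _ => e e0; exists 0%N => n _.
by rewrite /dyadic_Euler steps0 subrr hn0 add0r ltW.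
Qed.

Let TD s t x : 0 <= s -> 0 <= t -> T (s + t) x = T s (T t x).
Proof.
move=> s0 t0; apply/eqP; rewrite -subr_eq0; apply/eqP/hn_eps => e e0.
have [|x' [z [Axz hx]]] := @dissipative_domain_dense x (e / 2); first by lra.
suff TA : T (s + t) x' = T s (T t x').
  have -> : T (s + t) x - T s (T t x) = T (s + t) (x - x') - T s (T t (x - x')).
    by rewrite !TB TA; hilbert_ring.
  have := hnB (T (s + t) (x - x')) (T s (T t (x - x'))).
  have := T_contraction (s + t) (x - x').
  have := T_contraction s (T t (x - x')).
  have := T_contraction t (x - x'); lra.
apply/eqP; rewrite -subr_eq0; apply/eqP/hn_le0.
apply: lim_hn_le (@T_cvg _ _) _ => {hx}e {}e0; rewrite add0r.
have z0 := hn_ge0 z; have [|N hN] := @mesh_lt (e / 3 / (hn z + 1)).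
  by rewrite !divr_gt0 //; lra.
have [|N1 hN1] := (cvg_hn_seqP _ _).1 (@T_cvg t x') (e / 3); first by lra.
have [|N2 hN2] := (cvg_hn_seqP _ _).1 (@T_cvg s (T t x')) (e / 3); first by lra.
exists (maxn N (maxn N1 N2)) => n; rewrite !geq_max => /and3P[/hN h /hN1 h1 /hN2 h2].
(* On the grid the semigroup law fails by at most one step of size [mesh n]. *)
have h3 : hn (E n (s + t) x' - E n s (E n t x')) <= mesh n * hn z.
  rewrite /dyadic_Euler -iterD; case: (stepsD n s0 t0) => ->.
    by rewrite subrr hn0 mulr_ge0 // ltW.
  rewrite iterSr -iter_EulerB //; apply: le_trans (iter_Euler_contraction _ _ _) _ => //.
  by apply: le_trans (iter_Euler_dist (mesh_gt0 n) 1 Axz) _; rewrite mul1r.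
have := hn_tri (E n s (E n t x')) (E n (s + t) x') (T s (T t x')).
have := hn_tri (E n s (T t x')) (E n s (E n t x')) (T s (T t x')).
rewrite -EB; have := E_contraction n s (E n t x' - T t x').
move: h; rewrite ltr_pdivlMr; last by lra.
have := mesh_gt0 n; lra.
Qed.

Let near0 (P : R -> Prop) (d : R) : 0 < d -> (forall t, 0 < t -> t < d -> P t) ->
  \forall t \near 0^'+, P t.
Proof.
move=> d0 h; near=> t; apply: h; near: t; [exact: nbhs_right_gt|exact: nbhs_right_lt].
Unshelve. all: by end_near. Qed.

Let T_strong x : T t x @[t --> 0^'+] --> x.
Proof.
apply/cvg_hnP => e e0.
have [|x' [z [Axz hx]]] := @dissipative_domain_dense x (e / 4); first by lra.
have z0 := hn_ge0 z; apply: (@near0 _ (e / 2 / (hn z + 1))).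
  by rewrite !divr_gt0 //; lra.
move=> t t0; rewrite ltr_pdivlMr => [ht|]; last by lra.
have -> : x - T t x = (x - x') - (T t x' - x') - T t (x - x').
  by rewrite TB; hilbert_ring.
have := hnB ((x - x') - (T t x' - x')) (T t (x - x')).
have := hnB (x - x') (T t x' - x'); have := T_contraction t (x - x').
have := T_dist (ltW t0) Axz; lra.
Qed.

Let T_gen p : A p -> (t^-1)%:C *: (T t p.1 - p.1) @[t --> 0^'+] --> p.2.
Proof.
case: p => x z Axz /=; apply/cvg_hnP => e e0.
have [|z' [w [Azw hz]]] := @dissipative_domain_dense z (e / 4); first by lra.
have w0 := hn_ge0 w; apply: (@near0 _ (e / 2 / (hn w + 1))).
  by rewrite !divr_gt0 //; lra.
move=> t t0; rewrite ltr_pdivlMr => [ht|]; last by lra.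
have -> : z - (t^-1)%:C *: (T t x - x) = - (t^-1)%:C *: (T t x - (x + t%:C *: z)).
  have tz : (t^-1)%:C *: (t%:C *: z) = z.
    by rewrite scalerA -rmorphM mulVf ?gt_eqF // scale1r.
  by rewrite -{1}tz; hilbert_ring.
rewrite scaleNr hnN hnZr ?invr_ge0 ?(ltW t0) // mulrC ltr_pdivrMr //.
apply: le_lt_trans (T_taylor (ltW t0) Axz Azw) _.
by rewrite mulrC ltr_pM2r //; lra.
Qed.

Let gen_diss p : (t^-1)%:C *: (T t p.1 - p.1) @[t --> 0^'+] --> p.2 ->
  Re (ip p.2 p.1) <= 0.
Proof.
case: p => x z /= /cvg_hnP h; apply: le0_eps => e e0; have x0 := hn_ge0 x.
have e1 : 0 < e / (hn x + 1) by rewrite divr_gt0 //; lra.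
have [t [ht t0]] := @filter_ex _ _ (at_right_proper_filter 0) _ (filterI (h _ e1) (nbhs_right_gt 0)).
rewrite ltr_pdivlMr in ht; last by lra.
pose q := (t^-1)%:C *: (T t x - x).
have q0 : Re (ip q x) <= 0.
  rewrite ipZl ReZ pmulr_rle0 ?invr_gt0 // ipBl ReB Re_ip subr_le0.
  apply: le_trans (Re_ip_le _ _) _; rewrite expr2 ler_wpM2r //.
rewrite -[z](subrK q) ipDl ReD; have := Re_ip_le (z - q) x.
have := hn_ge0 (z - q); rewrite -/q in ht; nra.
Qed.

(* Lumer-Phillips. The semigroup is the limit of backward Euler schemes with
   dyadic time steps. *)
Lemma dissipative_generates_C0 : generates_C0 A.
Proof.
exists (fun t => linear_pack (T_linear t)); last first.
  rewrite predeqE => -[x z]; split=> [/T_gen //|/= gxz].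
  (* Maximality: the element of [A] with the same image under [1 - A] differs from [(x, z)] by some
     [(d, d)], and dissipativity of the generator forces [d = 0]. *)
  have [x' [z' [Axz' f]]] := A_range ltr01 (x - z); rewrite scale1r in f.
  have gd : (t^-1)%:C *: (T t (x - x') - (x - x')) @[t --> 0^'+] --> z - z'.
    under eq_fun do rewrite TB.
    have -> : (fun t : R => (t^-1)%:C *: (T t x - T t x' - (x - x'))) =
       (fun t => (t^-1)%:C *: (T t x - x)) \- (fun t => (t^-1)%:C *: (T t x' - x')).
      by apply/funext => t /=; hilbert_ring.
    by apply: cvgB gxz _; exact: (T_gen Axz').
  have dz : z - z' = x - x'.
    apply/eqP; rewrite -subr_eq0; apply/eqP.
    have -> : z - z' - (x - x') = (x' - z') - (x - z) by hilbert_ring.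
    by rewrite f subrr.
  have := @gen_diss (x - x', z - z') gd; rewrite /= dz => /ip_eq0 d0.
  have xx : x = x' by apply/eqP; rewrite -subr_eq0 d0.
  by move: dz; rewrite d0 xx => /eqP; rewrite subr_eq0 => /eqP ->.
split=> //= t _.
by apply: (@bounded_linear_continuous _ _ _ (linear_pack (T_linear t)) 1) => x /=; rewrite mul1r.
Qed.

End LumerPhillips.

(** * Gram identities and invariant annihilators *)

(* The part of [x] orthogonal to the annihilator is a fixed point of the
   projection of [(l - m) (l - A)^-1], a strict contraction. *)
Lemma resolvent_invariance (R : realType) (X : hilbertType R) (A : set (X * X))
    (G : set X) (l m : R[i]) (K : R) :
  subspace A ->
  (forall f, exists x z, A (x, z) /\ l *: x - z = f) ->
  (forall x z, A (x, z) -> hn x <= K * hn (l *: x - z)) ->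
  (forall x z, A (x, z) -> annihilator G (l *: x - z) -> annihilator G x) ->
  Re `|l - m| * K < 1 ->
  forall x z, A (x, z) -> annihilator G (m *: x - z) -> annihilator G x.
Proof.
move=> A_sub surj AK inv lmK x z Axz Gx.
have [n Gn xn] := annihilator_projection G x.
have [r [s [Ars rs]]] := surj (x - n).
have GS := annihilator_subspace G.
(* Applying [l - A] to this vector gives [(m *: x - z) + (l - m) *: n], a sum of two elements of the
   annihilator. *)
have Gd : annihilator G (- (l - m) *: r + x).
  apply: (inv _ (- (l - m) *: s + z)); first exact: (A_sub.2 _ (_, _) (_, _) Ars Axz).
  have -> : l *: (- (l - m) *: r + x) - (- (l - m) *: s + z) =
     (m *: x - z) + (l - m) *: n.
    have <- : x - (l *: r - s) = n by rewrite rs subKr.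
    by hilbert_ring.
  by apply: (subspaceD GS) => //; exact: (subspaceZ _ GS).
have h : Re (ip (x - n) (x - n)) = Re ((l - m) * ip r (x - n)).
  apply/eqP; rewrite -subr_eq0 -ReB -ipZl -ipBl.
  have -> : x - n - (l - m) *: r = - (l - m) *: r + x - n by hilbert_ring.
  by rewrite xn ?eqxx //; exact: (subspaceB GS).
have : hn (x - n) ^+ 2 <= Re `|l - m| * K * hn (x - n) ^+ 2.
  rewrite -[leLHS]Re_ip h -ipZl; apply: le_trans (Re_ip_le _ _) _.
  rewrite hnZ expr2 mulrA ler_wpM2r ?hn_ge0 // -mulrA ler_wpM2l ?Re_norm_ge0 //.
  by rewrite -rs; exact: AK.
have h0 := hn_ge0 (x - n) => h1.
have /eqP : hn (x - n) = 0.
  apply/eqP; rewrite -sqrf_eq0 eq_le sqr_ge0 andbT.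
  have := sqr_ge0 (hn (x - n)); nra.
by move=> /eqP /hn_eq0 /eqP; rewrite subr_eq0 => /eqP ->.
Qed.

Section Contraction.
Variables (R : realType) (U Y : hilbertType R) (phi : R[i] -> {linear U -> Y}).
Hypothesis phi_contr : forall l, Cplus l -> forall u, hn (phi l u) <= hn u.

Lemma schur_adjP l u y : Cplus l -> ip (phi l u) y = ip u (adj (phi l) y).
Proof.
move=> hl; apply: (@adjP _ _ _ (phi l) 1) => x; rewrite mul1r.
exact: phi_contr.
Qed.

Lemma schur_adj_contr l y : Cplus l -> hn (adj (phi l) y) <= hn y.
Proof.
move=> hl; set p := adj _ _; have p0 := hn_ge0 p.
have : hn p ^+ 2 <= hn p * hn y.
  rewrite -Re_ip -schur_adjP //; apply: le_trans (Re_ip_le _ _) _.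
  by rewrite ler_wpM2r ?hn_ge0 //; exact: phi_contr.
have [->|pn0] := eqVneq (hn p) 0; first by rewrite hn_ge0.
by rewrite expr2 ler_pM2l // lt_neqAle eq_sym pn0.
Qed.

(* Expanding [|e (l + h) y - e l y|^2] by the Gram identity bounds it by
   [h |y|^2 / (2 Re l)^2]. *)
Lemma gram_continuous (V : hilbertType R) (e : R[i] -> Y -> V) l y :
  Cplus l ->
  (forall a b, 0 <= a -> 0 <= b ->
    (conjc (l + a%:C) + (l + b%:C)) * ip (e (l + a%:C) y) (e (l + b%:C) y) =
    ip y y - ip (adj (phi (l + a%:C)) y) (adj (phi (l + b%:C)) y)) ->
  forall x, (forall h, 0 < h -> ip (e (l + h%:C) y) x = 0) -> ip (e l y) x = 0.
Proof.
move=> hl gram x ex.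
suff : annihilator [set x] (e l y) by apply.
apply: annihilator_closed => eps eps0.
pose r := 2 * Re l; have r0 : 0 < r by rewrite mulr_gt0.
have y0 := hn_ge0 y; pose Y2 := hn y ^+ 2; have Y0 : 0 <= Y2 by exact: sqr_ge0.
(* Chosen to make [Y2 * h / r^2] smaller than [eps^2]; the 1 covers [y = 0]. *)
pose h := eps ^+ 2 * r ^+ 2 / (Y2 + 1).
have h0 : 0 < h by rewrite divr_gt0 ?mulr_gt0 ?exprn_gt0 //; lra.
exists (e (l + h%:C) y) => [_ ->|]; first exact: ex.
have hm : Cplus (l + h%:C) by rewrite /Cplus /= ReD /= addr_gt0.
rewrite -hn_lt_sqr //.
have sumE a b : conjc (l + a%:C) + (l + b%:C) = (r + (a + b))%:C.
  apply: complex_eqP; rewrite /r; case: (l) => u v /=; ring.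
have Re_gram a b : 0 <= a -> 0 <= b -> (r + (a + b)) *
    Re (ip (e (l + a%:C) y) (e (l + b%:C) y)) =
    Y2 - Re (ip (adj (phi (l + a%:C)) y) (adj (phi (l + b%:C)) y)).
  by move=> a0 b0; rewrite -ReZ -sumE gram // ReB Re_ip.
have G00 := Re_gram 0 0 (lexx _) (lexx _).
have Gh := Re_gram h h (ltW h0) (ltW h0).
have G0h := Re_gram 0 h (lexx _) (ltW h0).
have lE : l + (0 : R)%:C = l by rewrite addr0.
rewrite !lE ?addr0 ?add0r in G00 G0h.
set p := adj (phi l) y in G00 G0h; set q := adj (phi _) y in Gh G0h.
have qy : hn q ^+ 2 <= Y2.
  by rewrite ler_sqr ?nnegrE ?hn_ge0 //; exact: schur_adj_contr.
have pq : 2 * Re (ip p q) <= hn p ^+ 2 + hn q ^+ 2.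
  have := sqr_ge0 (hn (p - q)); rewrite -!Re_ip ipBl !ipBr !ReB (Re_ipC q p); lra.
have DE : hn (e (l + h%:C) y - e l y) ^+ 2 = Re (ip (e l y) (e l y)) +
   Re (ip (e (l + h%:C) y) (e (l + h%:C) y)) - 2 * Re (ip (e l y) (e (l + h%:C) y)).
  by rewrite -Re_ip ipBl !ipBr !ReB (Re_ipC _ (e l y)); ring.
have D0 := sqr_ge0 (hn (e (l + h%:C) y - e l y)).
move: DE G00 Gh G0h D0; rewrite !Re_ip.
set D2 := hn _ ^+ 2; set a := hn (e l y) ^+ 2; set b := hn (e _ y) ^+ 2.
set c := Re (ip (e l y) _) => DE G00 Gh G0h D0.
(* The denominators [r], [r + h] and [r + 2 h] of the three Gram identities are cleared. *)
have h1 : (r * (r + h) * D2) * (r + (h + h)) =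
    (r * a) * (r + h) * (r + (h + h)) + ((r + (h + h)) * b) * r * (r + h)
    - 2 * ((r + h) * c) * r * (r + (h + h)) by rewrite DE; ring.
have h2 : r * (r + h) * D2 <= Y2 * h.
  have rh : 0 < r + (h + h) by lra.
  rewrite -(ler_pM2r rh) h1 G00 Gh G0h.
  have := sqr_ge0 (hn p); set P := hn p ^+ 2 in pq *; set Q := hn q ^+ 2 in pq qy *.
  set s := Re _ in pq * => P0.
  have hr : 0 <= r * h by rewrite mulr_ge0 // ltW.
  have t1 : 0 <= r * (r + (h + h)) * (P + Q - 2 * s).
    by apply: mulr_ge0; [apply: mulr_ge0|]; lra.
  have t2 : 0 <= P * (h * (r + (h + h))).
    by apply: mulr_ge0 => //; apply: mulr_ge0; lra.
  have t3 : 0 <= (r * h) * (Y2 - Q) by rewrite mulr_ge0 // subr_ge0.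
  have -> : (Y2 - P) * (r + h) * (r + (h + h)) + (Y2 - Q) * r * (r + h) -
     2 * (Y2 - s) * r * (r + (h + h)) = Y2 * h * (r + (h + h)) -
     r * (r + (h + h)) * (P + Q - 2 * s) - P * (h * (r + (h + h))) -
     (r * h) * (Y2 - Q) by ring.
  lra.
have h3 : r ^+ 2 * D2 <= Y2 * h.
  apply: le_trans h2; rewrite ler_wpM2r // expr2 ler_wpM2l ?(ltW r0) //; lra.
have r2 : 0 < r ^+ 2 by rewrite exprn_gt0.
rewrite -(ltr_pM2l r2); apply: le_lt_trans h3 _.
rewrite /h mulrA ltr_pdivrMr; last by lra.
have : 0 < eps ^+ 2 * r ^+ 2 by rewrite mulr_gt0 // exprn_gt0.
by lra.
Qed.

End Contraction.

(** * The reproducing kernel model *)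

Lemma Re_pinfty_filter (R : realType) : Filter (@Re_pinfty R).
Proof.
split=> [|P Q [M hM] [N hN]|P Q PQ [M hM]].
- by exists 0.
- exists (Num.max M N) => l; rewrite /half_plane /= gt_max => /andP[h1 h2].
  by split; [exact: hM|exact: hN].
- by exists M => l /hM /PQ.
Qed.

Section Model.
Variables (R : realType) (U Y H : hilbertType R).
Variables (phi : R[i] -> {linear U -> Y}) (ev : H -> R[i] -> Y).
Hypothesis phi_contr : forall l, Cplus l -> forall u, hn (phi l u) <= hn u.
Hypothesis H_rkhs : is_RKHS ev (K_o phi).
Implicit Types (l m : R[i]) (x z f : H) (u : U) (y : Y).

Definition rkernel l y : H := xget 0 [set k | (forall m, Cplus m -> ev k m = K_o phi m l y) /\
  forall f, ip f k = ip (ev f l) y].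

Let rkernelP l y : Cplus l -> (forall m, Cplus m -> ev (rkernel l y) m = K_o phi m l y) /\
  forall f, ip f (rkernel l y) = ip (ev f l) y.
Proof.
move=> hl; rewrite /rkernel; case: xgetP => [k _ //|/(_ _)/= nex].
by have [k h1 h2] := rkhs_kernel H_rkhs y hl; case: (nex k).
Qed.

Lemma Cplus_add_neq0 l m : Cplus l -> Cplus m -> conjc l + m != 0.
Proof.
rewrite /Cplus /= => hl hm; apply: contraTneq (addr_gt0 hl hm) => h.
by rewrite -(Re_conjc l) -ReD h ltxx.
Qed.

Lemma ip_rkernel f l y : Cplus l -> ip f (rkernel l y) = ip (ev f l) y.
Proof. by move=> hl; rewrite (rkernelP y hl).2. Qed.

Lemma ev_rkernel l m y : Cplus l -> Cplus m ->
  (conjc l + m) *: ev (rkernel l y) m = y - phi m (adj (phi l) y).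
Proof.
move=> hl hm; rewrite (rkernelP y hl).1 // /K_o scalerA conjCE addrC mulfV ?scale1r //.
by rewrite addrC Cplus_add_neq0.
Qed.

Lemma rkernel_gram l m y y' : Cplus l -> Cplus m ->
  (conjc l + m) * ip (rkernel l y) (rkernel m y') =
  ip y y' - ip (adj (phi l) y) (adj (phi m) y').
Proof.
move=> hl hm; rewrite ip_rkernel // -ipZl ev_rkernel // ipBl.
by rewrite (schur_adjP phi_contr).
Qed.

Lemma evP l a f g : Cplus l -> ev (a *: f + g) l = a *: ev f l + ev g l.
Proof. by move=> hl; exact: (rkhs_linear H_rkhs). Qed.
Lemma ev0 l : Cplus l -> ev 0 l = 0.
Proof.
move=> hl; apply: ip_inj => y.
by rewrite -ip_rkernel // !ip0l.
Qed.
Lemma evZ l a f : Cplus l -> ev (a *: f) l = a *: ev f l.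
Proof. by move=> hl; rewrite -[a *: f]addr0 evP // ev0 // addr0. Qed.
Lemma evD l f g : Cplus l -> ev (f + g) l = ev f l + ev g l.
Proof. by move=> hl; rewrite -[f]scale1r evP // !scale1r. Qed.
Lemma evN l f : Cplus l -> ev (- f) l = - ev f l.
Proof. by move=> hl; rewrite -scaleN1r evZ // scaleN1r. Qed.
Lemma evB l f g : Cplus l -> ev (f - g) l = ev f l - ev g l.
Proof. by move=> hl; rewrite evD // evN. Qed.

(** For the kernel vector [k] at [v = f(l)] one has [|v|^2 = <f, k>], and the Gram identity bounds
    [|k|]. The decay in [Re l] makes [y] unique and equal to the limit. *)
Lemma ev_bound l f : Cplus l -> 2 * Re l * hn (ev f l) ^+ 2 <= hn f ^+ 2.
Proof.
move=> hl; set v := ev f l; set k := rkernel l v.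
have l0 : 0 < 2 * Re l by rewrite mulr_gt0.
have h1 : hn v ^+ 2 <= hn f * hn k.
  by rewrite -Re_ip -ip_rkernel //; exact: Re_ip_le.
have h2 : 2 * Re l * hn k ^+ 2 <= hn v ^+ 2.
  have := congr1 (@complex.Re R) (rkernel_gram v v hl hl).
  have -> : conjc l + l = (2 * Re l)%:C.
    by apply: complex_eqP; case: (l) => a b /=; ring.
  by rewrite ReZ ReB !Re_ip => ->; have := sqr_ge0 (hn (adj (phi l) v)); lra.
have [->|v0] := eqVneq (hn v) 0; first by rewrite expr0n /= mulr0 sqr_ge0.
have vp : 0 < hn v ^+ 2 by rewrite exprn_gt0 // lt_neqAle eq_sym v0 hn_ge0.
rewrite -(ler_pM2r vp).
have h3 : (hn v ^+ 2) ^+ 2 <= hn f ^+ 2 * hn k ^+ 2.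
  by rewrite -exprMn ler_sqr ?nnegrE ?sqr_ge0 ?mulr_ge0 ?hn_ge0.
have h4 : hn f ^+ 2 * (2 * Re l * hn k ^+ 2) <= hn f ^+ 2 * hn v ^+ 2.
  by rewrite ler_wpM2l // sqr_ge0.
by nra.
Qed.

Lemma Cplus_shift l (a : R) : Cplus l -> 0 <= a -> Cplus (l + a%:C).
Proof. by rewrite /Cplus /= ReD /= => h a0; rewrite ltr_wpDr. Qed.

Lemma ev_shift0 f l : Cplus l -> (forall h : R, 0 < h -> ev f (l + h%:C) = 0) ->
  ev f l = 0.
Proof.
move=> hl h; apply: ip_inj => y; rewrite ip0l -ip_rkernel // ip_conj.
rewrite (gram_continuous phi_contr (e := rkernel)) ?conjc0 //.
  by move=> a b a0 b0; rewrite rkernel_gram //; exact: Cplus_shift.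
move=> a a0; rewrite ip_conj ip_rkernel ?h ?ip0l ?conjc0 //.
by apply: Cplus_shift (ltW _).
Qed.

(** Fills in the one point where a resolvent equation leaves the value of [f] undetermined. *)
Lemma ev_punctured0 f l (w : R) : 0 <= w -> w < Re l ->
  (forall m, w < Re m -> m != l -> ev f m = 0) -> ev f l = 0.
Proof.
move=> w0 wl h; apply: ev_shift0 => [|a a0]; first exact: le_lt_trans wl.
apply: h; first by rewrite ReD /= ltr_wpDr // ltW.
rewrite -subr_eq0 addrAC subrr add0r; apply/eqP => /(congr1 (@complex.Re R)) /= a1.
by rewrite a1 ltxx in a0.
Qed.

Local Notation So := (So_eq phi ev).

Lemma So_eqP a x u z y x' u' z' y' : So x u z y -> So x' u' z' y' ->
  So (a *: x + x') (a *: u + u') (a *: z + z') (a *: y + y').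
Proof.
move=> h h' m hm; rewrite !evP // linearP (h m hm) (h' m hm).
by hilbert_ring.
Qed.

Lemma So_eqB x u z y x' u' z' y' : So x u z y -> So x' u' z' y' ->
  So (x - x') (u - u') (z - z') (y - y').
Proof.
move=> h h'; have := So_eqP (-1) h' h.
by rewrite !scaleN1r ![- _ + _]addrC.
Qed.

Lemma So_eq0 : So 0 0 0 0.
Proof. by move=> m hm; rewrite !ev0 // scaler0 linear0 addr0 subrr. Qed.

(** Here [z] is the constant [- y], while by [ev_bound] its values at large real points are
    small. *)
Lemma So_eq_zero z y : So 0 0 z y -> y = 0 /\ z = 0.
Proof.
move=> h; have zE m : Cplus m -> ev z m = - y.
  by move=> hm; rewrite h // ev0 // scaler0 linear0 addr0 sub0r.
suff y0 : y = 0.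
  split=> //; apply: (rkhs_ext H_rkhs) => m hm.
  by rewrite zE // ev0 // y0 oppr0.
apply: hn_eps => e e0; have z0 := hn_ge0 z; have y0 := hn_ge0 y.
have [//|lt] := leP (hn y) e.
pose r := hn z ^+ 2 / e ^+ 2 + 1.
have e2 : 0 < e ^+ 2 by rewrite exprn_gt0.
have r1 : 1 <= r by rewrite lerDr divr_ge0 // sqr_ge0.
have hr : Cplus (r%:C : R[i]) by rewrite /Cplus /=; lra.
have := ev_bound z hr; rewrite zE // hnN /= => yz.
have ey : e ^+ 2 <= hn y ^+ 2 by rewrite ler_sqr ?nnegrE ?(ltW e0) ?(ltW lt).
have rE : r * e ^+ 2 = hn z ^+ 2 + e ^+ 2.
  by rewrite /r mulrDl mul1r divfK // gt_eqF.
have : r * e ^+ 2 <= r * hn y ^+ 2 by rewrite ler_wpM2l //; lra.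
by have := sqr_ge0 (hn z); lra.
Qed.

Lemma So_eq_uniq x u z y z' y' : So x u z y -> So x u z' y' -> y = y' /\ z = z'.
Proof.
move=> h h'; have := So_eqB h h'; rewrite !subrr => /So_eq_zero[/eqP + /eqP].
by rewrite !subr_eq0 => /eqP -> /eqP ->.
Qed.

Lemma So_eq_lim x u z y : So x u z y -> So_lim phi ev x u y.
Proof.
move=> h; apply/(cvg_hnP (FF := Re_pinfty_filter R)) => e e0.
exists (hn z ^+ 2 / e ^+ 2) => l hl.
have e2 : 0 < e ^+ 2 by rewrite exprn_gt0.
have l0 : Cplus l by apply: le_lt_trans hl; rewrite divr_ge0 // sqr_ge0.
have -> : y - (l *: ev x l + phi l u) = - ev z l by rewrite h // opprB.
rewrite hnN -hn_lt_sqr //; have := ev_bound z l0.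
move: hl; rewrite /half_plane /= ltr_pdivrMr // => h1 h2.
have l1 : 0 < Re l by [].
rewrite -(ltr_pM2l l1); have := sqr_ge0 (hn (ev z l)); nra.
Qed.

Lemma S_oE x u z y : S_o phi ev ((x, u), (z, y)) <-> So x u z y.
Proof.
split=> [[]//|h]; split=> //; first by exists y, z.
exact: So_eq_lim h.
Qed.

Lemma dom_SoE : dom (S_o phi ev) = dom_So phi ev.
Proof.
rewrite predeqE => -[x u]; split=> [[[z y] /S_oE h]|[y [z h]]]; first by exists y, z.
by exists (z, y); apply/S_oE.
Qed.

Let rk_set : set ((H * Y) * (H * U)) :=
  [set p | exists l y, Cplus l /\
     p = ((rkernel l y, y), (conjc l *: rkernel l y, adj (phi l) y))].

(** On the diagonal this is the energy balance of a node with input in [Y] and output in [U], as for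
    the adjoint. *)
Let energy (p q : (H * Y) * (H * U)) : R[i] :=
  ip p.2.1 q.1.1 + ip p.1.1 q.2.1 - ip p.1.2 q.1.2 + ip p.2.2 q.2.2.

Let energy0 p : lspan rk_set p -> energy p p = 0.
Proof.
move=> hp; apply: (@lspan_form0 _ _ energy rk_set _ _ _ p p) => //.
- by move=> a x y z; rewrite /energy /= !ipDl !ipZl; ring.
- by move=> a x y z; rewrite /energy /= !ipDr !ipZr; ring.
move=> _ _ [l [y [hl ->]]] [m [y' [hm ->]]]; rewrite /energy /=.
have := rkernel_gram y y' hl hm; rewrite ipZl ipZr conjcKE => h.
rewrite mulrDl in h; rewrite h; ring.
Qed.

(* The kernel elements span a relation on which the Cayley transform
   [alpha x - z |-> conj alpha x + z] is isometric; a vector representing its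
   adjoint at [(f, u)] solves the resolvent equation. *)
Lemma So_resolvent b f u : Cplus b -> exists x z y,
  [/\ So x u z y, b *: x - z = f & 2 * Re (ip z x) <= hn u ^+ 2 - hn y ^+ 2].
Proof.
(* The difference of [|conj a x + z|^2] and [|a x - z|^2] is [k (<z, x> + <x, z>)], so weight [k] on
   inputs and outputs turns zero energy into isometry. *)
move=> hb'; pose k := 2 * Re b; have k0 : 0 < k by rewrite mulr_gt0.
pose a := conjc b.
have kE : k%:C = a + b.
  by rewrite /k /a; apply: complex_eqP; case: (b) => s t /=; ring.
pose E1 := hform_sum (hform_ip H) (hform_ip Y) k0.
pose E2 := hform_sum (hform_ip H) (hform_ip U) k0.
pose L (d : H * Y) (c : R[i]) := exists2 p, lspan rk_set p &
  d = (a *: p.1.1 - p.2.1, p.1.2) /\ c = E2 (conjc a *: p.1.1 + p.2.1, p.2.2) (f, u).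
have [|s d c d' c' [p hp [-> ->]] [q hq [-> ->]]|d c [p hp [-> ->]]||[g y] [gL gq _]] :=
    @riesz R (H * Y)%type E1 L (Re (E2 (f, u) (f, u))).
- exists 0; first exact: (lspan_subspace _).1.
  by rewrite hform_sumE /= !scaler0 subrr addr0 !ip0l mulr0 addr0.
- exists (s *: p + q); first exact: (lspan_subspace _).2.
  rewrite -hb_linear; split.
    by apply/pair_equal_spec; split=> /=; hilbert_ring.
  congr (E2 _ _); apply/pair_equal_spec; split=> //=; by hilbert_ring.
- rewrite mulrC; apply: le_trans (cauchy_schwarz E2 _ _) _.
  rewrite le_eqVlt; apply/orP; left; apply/eqP; congr (_ * _).
  have := energy0 hp; rewrite /energy; move: p hp => [[x1 y1] [z1 u1]] _ /= h.
  congr complex.Re; rewrite !(ipDl, ipDr, ipNl, ipNr, ipZl, ipZr).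
  rewrite kE /a !conjcKE; apply/eqP; rewrite -subr_eq0; apply/eqP.
  by apply: (@etrans _ _ ((conjc b + b) * 0)); [rewrite -h; ring|rewrite mulr0].
- exact: hb_ge0.
(* Inverse Cayley transform: solves [f = b x - z] and [g = a x + z]. *)
pose x := (k^-1)%:C *: (f + g); pose z := b *: x - f.
have kx : (a + b) *: x = f + g.
  by rewrite -kE scalerA -rmorphM divff ?scale1r // gt_eqF.
have gE : g = a *: x + z by rewrite /z addrA -scalerDl kx addrAC subrr add0r.
have ab0 : a + b != 0 by exact: Cplus_add_neq0.
exists x, z, y; split; last 1 first.
(* The norm bound from [riesz], [|g|^2 + k |y|^2 <= |f|^2 + k |u|^2], is [k] times the passivity
   inequality. *)
- move: gq; rewrite /= !ReD !ReZ !Re_ip -!Re_ip => gq.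
  have fE : f = b *: x - z by rewrite /z subKr.
  have : Re (ip g g) - Re (ip f f) = k * (2 * Re (ip z x)).
    rewrite gE fE -ReB.
    have -> : ip (a *: x + z) (a *: x + z) - ip (b *: x - z) (b *: x - z) =
        k%:C * (ip z x + ip x z).
      by rewrite kE !(ipDl, ipDr, ipZl, ipZr, ipNl, ipNr) /a conjcKE; ring.
    by rewrite ReZ ReD (Re_ipC x z); ring.
  by rewrite !Re_ip in gq *; nra.
- move=> m hm; apply: (scalerI ab0).
  apply: ip_inj => y'.
  have /(gL _ _) : L (a *: rkernel m y' - conjc m *: rkernel m y', y')
      (E2 (conjc a *: rkernel m y' + conjc m *: rkernel m y', adj (phi m) y') (f, u)).
    exists ((rkernel m y', y'), (conjc m *: rkernel m y', adj (phi m) y')) => //.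
    by apply: sub_lspan; exists m, y'.
  rewrite /= ipBl ipDl !ipZl kE => /(congr1 (@conjc R)).
  rewrite !conjcD !conjcM !conjcD !conjcN !conjcM !conjcKE -!ip_conj => h.
  have hX : (a + b) * ip x (rkernel m y') =
      ip f (rkernel m y') + ip g (rkernel m y') by rewrite -ipZl kx ipDl.
  rewrite ipBl ipDl ipZl (schur_adjP phi_contr) // -!ip_rkernel //.
  rewrite /z ipBl ipZl; move: h hX; rewrite -/a.
  set F := ip f _; set G := ip g _; set X := ip x _; set u' := ip u _.
  set v := ip y _ => h hX.
  apply/eqP; rewrite -subr_eq0; apply/eqP.
  apply: (@etrans _ _ ((b - m) * ((a + b) * X - (F + G)) -
    ((a * F + m * F + (b + a) * u') - (b * G + - (m * G) + (b + a) * v)))).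
    by ring.
  by rewrite hX h; ring.
by rewrite /z subKr.
Qed.

End Model.

(** * Resolvents *)

Lemma hn_pairE (R : realType) (V W : normedModType R[i]) (p : V * W) :
  hn p = Num.max (hn p.1) (hn p.2).
Proof.
apply: complexI; rewrite -hnE; transitivity (Num.max `|p.1| `|p.2|) => //.
by rewrite !hnE !maxEle lecR; case: ifP.
Qed.

Lemma hn_pair_lt (R : realType) (V W : normedModType R[i]) (p : V * W) (e : R) :
  hn p < e <-> hn p.1 < e /\ hn p.2 < e.
Proof. by rewrite hn_pairE gt_max; split=> /andP. Qed.

Section Resolvent.
Variables (R : realType) (X : normedModType R[i]) (A : set (X * X)).
Implicit Types (l : R[i]) (x z v : X).

Lemma resolventP l v : res A l ->
  exists2 z, A (resolvent A l v, z) & l *: resolvent A l v - z = v.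
Proof.
move=> [/(_ v)[x [hx _]] _]; rewrite /resolvent; case: xgetP => [? _ //|nex].
by case: (nex x).
Qed.

Lemma resolventK l x z : res A l -> A (x, z) -> resolvent A l (l *: x - z) = x.
Proof.
move=> hl Axz; have [z' A' zE] := resolventP (l *: x - z) hl.
case: hl => /(_ (l *: x - z))[x0 [_ uniq]] _.
by rewrite -(uniq _ (ex_intro2 _ _ z' A' zE)); apply: uniq; exists z.
Qed.

Lemma res_bound l : res A l ->
  exists K : R, 0 <= K /\ forall x z, A (x, z) -> hn x <= K * hn (l *: x - z).
Proof.
move=> [_ [M hM]]; exists (Re `|M|); split=> [|x z Axz]; first exact: Re_norm_ge0.
have h := hM x z Axz; rewrite -hnZ -lecR -!hnE normrZ.
by have b0 := le_trans (normr_ge0 x) h; move: h; rewrite -(ger0_norm b0) normrM normr_id.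
Qed.

End Resolvent.

(** * The model operator: resolvent, closedness, dense domain, co-energy balance *)

Section ModelNode.
Variables (R : realType) (U Y H : hilbertType R).
Variables (phi : R[i] -> {linear U -> Y}) (ev : H -> R[i] -> Y).
Hypothesis phi_contr : forall l, Cplus l -> forall u, hn (phi l u) <= hn u.
Hypothesis H_rkhs : is_RKHS ev (K_o phi).
Implicit Types (l m : R[i]) (x z f : H) (u : U) (y : Y).

Local Notation So := (So_eq phi ev).
Local Notation SoP := (S_oE phi_contr H_rkhs).

(** Evaluation at [b] kills [y]; then [(m - b) d(m) = 0], and the point [b] itself is filled in by
    [ev_punctured0]. *)
Lemma So_eq_inj b d y : Cplus b -> So d 0 (b *: d) y -> d = 0.
Proof.
move=> hb' h; have y0 : y = 0.
  have := h b hb'; rewrite (evZ H_rkhs) // linear0 addr0.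
  by rewrite -[X in X = _ -> _]subr0 => /(addrI _) /oppr_inj.
have dE m : Cplus m -> m != b -> ev d m = 0.
  move=> hm mb; have := h m hm; rewrite (evZ H_rkhs) // linear0 addr0 y0 subr0.
  move/eqP; rewrite -subr_eq0 -scalerBl scaler_eq0 subr_eq0 eq_sym (negbTE mb).
  by move/eqP.
apply: (rkhs_ext H_rkhs) => m hm; rewrite (ev0 H_rkhs) //.
have [->|] := eqVneq m b; last exact: dE.
by apply: (ev_punctured0 phi_contr H_rkhs (lexx 0)).
Qed.

Lemma So_resolvent_uniq b x u z y x' z' y' : Cplus b -> So x u z y ->
  So x' u z' y' -> b *: x - z = b *: x' - z' -> [/\ x = x', z = z' & y = y'].
Proof.
move=> hb' h h' e; have := So_eqB H_rkhs h h'; rewrite subrr.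
have -> : z - z' = b *: (x - x').
  have -> : z - z' = b *: (x - x') - ((b *: x - z) - (b *: x' - z')) by hilbert_ring.
  by rewrite e subrr subr0.
move=> /(So_eq_inj hb') /eqP; rewrite subr_eq0 => /eqP xx.
move: h' => /[!(esym xx)] h'.
by have [-> ->] := So_eq_uniq phi_contr H_rkhs h h'.
Qed.

Lemma Cplus1 : Cplus (1 : R[i]). Proof. exact: ltr01. Qed.

(** [So_resolvent] gives passivity only for the solutions it constructs; by uniqueness at 1 every
    element is such a solution. *)
Lemma So_dissipative x u z y : So x u z y -> 2 * Re (ip z x) <= hn u ^+ 2 - hn y ^+ 2.
Proof.
move=> h; have [x' [z' [y' [h' e ineq]]]] :=
  So_resolvent phi_contr H_rkhs (1 *: x - z) u Cplus1.
by have [-> -> ->] := So_resolvent_uniq Cplus1 h h' (esym e).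
Qed.

Local Notation S := (S_o phi ev).
Local Notation A := (main_op (S_o phi ev)).

Lemma So_main x z : A (x, z) <-> exists y, So x 0 z y.
Proof. by split=> -[y h]; exists y; apply/SoP. Qed.

Lemma So_main_subspace : subspace A.
Proof.
split; first by apply/So_main; exists 0; exact: (So_eq0 H_rkhs).
move=> a [x z] [x' z'] /So_main[y h] /So_main[y' h']; apply/So_main.
exists (a *: y + y'); have := So_eqP H_rkhs a h h'.
by rewrite scaler0 addr0.
Qed.

Lemma So_main_diss x z : A (x, z) -> Re (ip z x) <= 0.
Proof.
move=> /So_main[y /So_dissipative]; rewrite hn0 expr0n /=.
by have := sqr_ge0 (hn y); lra.
Qed.

Lemma So_main_range b f : Cplus b -> exists x z, A (x, z) /\ b *: x - z = f.
Proof.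
move=> hb'; have [x [z [y [h e _]]]] := So_resolvent phi_contr H_rkhs f 0 hb'.
by exists x, z; split=> //; apply/So_main; exists y.
Qed.

Lemma So_main_fun z : A (0, z) -> z = 0.
Proof. by move=> /So_main[y] /(So_eq_zero phi_contr H_rkhs)[]. Qed.

Lemma So_main_range_real (r : R) : 0 < r -> forall f, exists x z, A (x, z) /\ r%:C *: x - z = f.
Proof. by move=> r0 f; exact: So_main_range. Qed.

Lemma So_generates : generates_C0 A.
Proof.
exact: (dissipative_generates_C0 So_main_subspace So_main_fun So_main_diss
  So_main_range_real).
Qed.

Lemma So_main_bound b x z : Cplus b -> A (x, z) ->
  hn x <= (Re b)^-1 * hn (b *: x - z).
Proof.
move=> hb' Axz; rewrite mulrC ler_pdivlMr //.
have [->|x0] := eqVneq x 0; first by rewrite hn0 mul0r hn_ge0.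
have xp : 0 < hn x.
  by rewrite lt_neqAle hn_ge0 andbT eq_sym; apply: contraNneq x0 => /hn_eq0 ->.
rewrite -(ler_pM2r xp); apply: le_trans (Re_ip_le _ _).
rewrite ipBl ReB ipZl ip_self_real [b * _]mulrC ReZ.
have := So_main_diss Axz; rewrite expr2; lra.
Qed.

Lemma So_res b : Cplus b -> res A b.
Proof.
move=> hb'; split=> [v|].
  have [x [z [Axz xz]]] := So_main_range v hb'.
  exists x; split=> [|x' [z' Axz' xz']]; first by exists z.
  move: Axz Axz' => /So_main[y h] /So_main[y' h'].
  by have [] := So_resolvent_uniq hb' h h'; rewrite ?xz ?xz'.
exists (Re b)^-1%:C => x z /(So_main_bound hb') h.
by rewrite !hnE -rmorphM lecR.
Qed.

Lemma So_linear_op : linear_op S.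
Proof.
split.
- by apply/SoP; exact: (So_eq0 H_rkhs).
- move=> a [[x u] [z y]] [[x' u'] [z' y']] /SoP h /SoP h'; apply/SoP.
  exact: (So_eqP H_rkhs a h h').
- move=> [x u] [z y] [z' y'] /SoP h /SoP h'.
  by have [-> ->] := So_eq_uniq phi_contr H_rkhs h h'.
Qed.

Lemma ev_hn m f : Cplus m -> hn (ev f m) <= Num.sqrt (2 * Re m)^-1 * hn f.
Proof.
move=> hm; have m0 : 0 < 2 * Re m by rewrite mulr_gt0.
rewrite -ler_sqr ?nnegrE ?mulr_ge0 ?hn_ge0 ?sqrtr_ge0 // exprMn sqr_sqrtr ?invr_ge0 ?(ltW m0) //.
by rewrite [leRHS]mulrC ler_pdivlMr // mulrC; exact: (ev_bound phi_contr H_rkhs).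
Qed.

Lemma So_closed : closed S.
Proof.
apply/closed_hnP => -[[x u] [z y]] h; apply/SoP => m hm.
apply/eqP; rewrite -subr_eq0; apply/eqP/hn_eps => e e0.
pose c := Num.sqrt (2 * Re m)^-1; have c0 : 0 <= c by rewrite sqrtr_ge0.
have m0 := Re_norm_ge0 m.
pose K := c + Re `|m| * c + 2; have K0 : 0 < K.
  by rewrite ltr_wpDl // addr_ge0 // mulr_ge0.
have [|[[x' u'] [z' y']] /SoP So' /hn_pair_lt[/hn_pair_lt[/= hx hu] /hn_pair_lt[/= hz hy]]] := h (e / K).
  by rewrite divr_gt0.
have -> : ev z m - (m *: ev x m + phi m u - y) =
    ev (z - z') m - m *: ev (x - x') m - phi m (u - u') + (y - y').
  rewrite !(evB H_rkhs) // (So' m hm) [phi m (u - u')]linearB; hilbert_ring.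
apply: le_trans (hnD _ _) _; have := hnB (ev (z - z') m - m *: ev (x - x') m) (phi m (u - u')).
have := hnB (ev (z - z') m) (m *: ev (x - x') m); rewrite hnZ.
have := phi_contr hm (u - u').
have := ev_hn (z - z') hm; have := ev_hn (x - x') hm; rewrite -/c => h1 h2 h3 h4 h5.
have h6 : Re `|m| * hn (ev (x - x') m) <= Re `|m| * (c * (e / K)).
  by rewrite ler_wpM2l //; apply: le_trans h1 _; rewrite ler_wpM2l // ltW.
have h7 : c * hn (z - z') <= c * (e / K) by rewrite ler_wpM2l // ltW.
have -> : e = K * (e / K) by rewrite mulrC divfK // gt_eqF.
rewrite {1}/K; lra.
Qed.

(** Some [(b, u)] lies in the domain for every [u]; the error [x - b] is then corrected inside the
    dense domain of the main operator. *)
Lemma So_dom_dense : dense (dom_So phi ev).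
Proof.
apply/dense_hnP => -[x u] e e0.
have [b [zb [yb [hb' bE _]]]] := So_resolvent phi_contr H_rkhs 0 u Cplus1.
have [x' [z' [/So_main[y' h] hx]]] :=
  dissipative_domain_dense So_main_subspace So_main_fun So_main_diss
    So_main_range_real (x - b) e0.
exists (x' + b, u).
  exists (y' + yb), (z' + zb) => /=.
  have := So_eqP H_rkhs 1 h hb'.
  by rewrite !scale1r add0r.
apply/hn_pair_lt; split=> /=; last by rewrite subrr hn0.
by have -> : x - (x' + b) = x - b - x' by hilbert_ring.
Qed.

Lemma So_co_energy : co_energy_preserving S.
Proof.
move=> x y z u hp.
(* Pairing with kernel elements of [S_o] puts the adjoint pair, with these signs, back into [S_o];
   it can then be tested against itself. *)
have hS : So (- x) (- u) z (- y).
  move=> m hm; apply: ip_inj => y'.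
  have hk : S ((rkernel phi ev m y', adj (phi m) y'),
               (- (conjc m *: rkernel phi ev m y'), y')).
    apply/SoP => n hn'; rewrite (evN H_rkhs) // (evZ H_rkhs) //.
    have := ev_rkernel H_rkhs y' hm hn'; rewrite scalerDl => e.
    apply/eqP; rewrite -subr_eq0; apply/eqP.
    have -> : - (conjc m *: ev (rkernel phi ev m y') n) -
      (n *: ev (rkernel phi ev m y') n + phi n (adj (phi m) y') - y') =
      y' - phi n (adj (phi m) y') - (conjc m *: ev (rkernel phi ev m y') n +
        n *: ev (rkernel phi ev m y') n) by hilbert_ring.
    by rewrite e subrr.
  have := hp _ _ hk; rewrite /ip2 /= ipNl ipZl => /(congr1 (@conjc R)).
  rewrite !conjcD conjcN conjcM conjcKE -!ip_conj.
  rewrite !(ip_rkernel H_rkhs) // -(schur_adjP phi_contr) //.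
  rewrite (evN H_rkhs) // scalerN [phi m (- u)]linearN => e.
  rewrite !(ipDl, ipNl, ipZl); apply/eqP; rewrite -subr_eq0; apply/eqP.
  apply: (@etrans _ _ ((ip (ev z m) y' + ip (phi m u) y') -
     (- (m * ip (ev x m) y') + ip y y'))); first by ring.
  by rewrite e subrr.
have /SoP hS' := hS.
have := hp _ _ hS'; rewrite /ip2 /= !ipNl !ip_norm => e.
apply/eqP; rewrite -subr_eq0; apply/eqP.
apply: (@etrans _ _ ((ip z x - ip y y) - (- ip x z - ip u u))); first by ring.
by rewrite e subrr.
Qed.

End ModelNode.

(** Convexity: the segment from [m] to a point of the half-plane stays in [C^+]. *)
Lemma Cplus_rho_infty (R : realType) (X : hilbertType R) (A : set (X * X)) :
  @Cplus R `<=` res A -> @Cplus R `<=` rho_infty A.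
Proof.
move=> CA m hm; exists 0 => l hl.
pose f (t : R) : R[i]^o := m + t%:C * (l - m).
have fc : continuous f.
  move=> t; apply/(cvg_hnP (FF := nbhs_filter t)) => e e0.
  pose K := Re `|l - m| + 1; have K0 : 0 < K by rewrite ltr_wpDl ?Re_norm_ge0.
  exists (e / K) => [/=|s /=]; first by rewrite divr_gt0.
  rewrite ltr_pdivlMr // => hs; apply: le_lt_trans hs.
  have -> : f t - f s = (t - s)%:C * (l - m) by rewrite /f rmorphB /=; ring.
  rewrite /hn Re_normM normc_def /= expr0n addr0 sqrtr_sqr.
  by rewrite ler_wpM2l //; apply: ler_wpDr ler01 _.
pose B := f @` [set` `[0, 1]%R].
apply: (@connected_component_max R[i]^o _ B).
- exists 0 => /=; first by rewrite in_itv /= lexx ler01.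
  by rewrite /f (rmorph0 (real_complex R)) mul0r addr0.
- move=> _ [t ht <-]; apply: CA; move: ht; rewrite /= in_itv /= => /andP[t0 t1].
  rewrite /Cplus /= /f ReD ReZ ReB.
  by have m0 : 0 < Re m := hm; have l0 : 0 < Re l := hl; nra.
- apply: connected_continuous_connected; first exact: segment_connected.
  exact: continuous_subspaceT.
- exists 1 => /=; first by rewrite in_itv /= lexx ler01.
  by rewrite /f (rmorph1 (real_complex R)) mul1r addrC subrK.
Qed.

(** * The extended operators, transfer function and observability of the model *)

Section ModelRigging.
Variables (R : realType) (U Y H : hilbertType R).
Variables (phi : R[i] -> {linear U -> Y}) (ev : H -> R[i] -> Y).
Hypothesis phi_contr : forall l, Cplus l -> forall u, hn (phi l u) <= hn u.
Hypothesis H_rkhs : is_RKHS ev (K_o phi).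
Implicit Types (l m : R[i]) (x z f : H) (u : U) (y : Y).

Local Notation So := (So_eq phi ev).
Local Notation SoP := (S_oE phi_contr H_rkhs).
Local Notation S := (S_o phi ev).
Local Notation A := (main_op (S_o phi ev)).
Local Notation AP := (So_main phi_contr H_rkhs).

(** [b] is [(m - A|X)^-1 B u]. In the model equation at [m] the terms [m b(m)] cancel, leaving
    [y = phi m u]: this is the transfer function. *)
Lemma So_control m u : Cplus m -> exists b, So b u (m *: b) (phi m u).
Proof.
move=> hm; have [b [z [y [h e _]]]] := So_resolvent phi_contr H_rkhs 0 u hm.
exists b; have zE : z = m *: b by apply/esym/eqP; rewrite -subr_eq0 e.
suff <- : y = phi m u by rewrite -zE.
have := h m hm; rewrite zE (evZ H_rkhs) // => /eqP.
by rewrite -addrA addrC -subr_eq subrr eq_sym subr_eq0 => /eqP ->.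
Qed.

Let A1 : res A 1. Proof. exact: (So_res phi_contr H_rkhs (@Cplus1 R)). Qed.

Local Notation J := (resolvent A 1).

Let JP v : A (J v, J v - v).
Proof.
by have [z Az e] := resolventP v A1; rewrite -{3}e scale1r subKr.
Qed.
Let JK x z : A (x, z) -> J (x - z) = x.
Proof. by move=> /(resolventK A1); rewrite scale1r. Qed.

Let J_linear : linear J.
Proof.
move=> a v w; rewrite -[RHS](JK (z := a *: (J v - v) + (J w - w))).
  by congr J; hilbert_ring.
exact: ((So_main_subspace phi_contr H_rkhs).2 a _ _ (JP v) (JP w)).
Qed.

(* [A] is boundedly invertible at [1], so [(1 - A)^-1 : H -> H] itself serves as
   the embedding of [H] into [X_{-1}], and no completion has to be built. *)
Let rg : rigging A.
Proof.
refine (@Rigging R H A 1 A1 H (linear_pack J_linear) (fun x => erefl) _).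
apply/dense_hnP => x e e0.
have [x' [z' [Axz hx]]] := dissipative_domain_dense (So_main_subspace phi_contr H_rkhs)
  (So_main_fun phi_contr H_rkhs) (So_main_diss phi_contr H_rkhs)
  (So_main_range_real phi_contr H_rkhs) x e0.
by exists x' => //; exists (x' - z') => //=; exact: JK.
(* Transparent, since [rig_space rg] has to compute to [H] below. *)
Defined.

(** Seen through the embedding [J = (1 - A)^-1], the operator [A|X] is [J - 1], and [B u] is the
    vector of [So_control] at 1. *)
Lemma model_rigging : exists (rg : rigging A) (E : node_ext rg),
  forall m u, Cplus m -> transfer_function E m u = phi m u.
Proof.
have /choice[B hB] := fun u => So_control u (@Cplus1 R).
have B_uniq u b y : So b u (1 *: b) y -> b = B u.
  move=> h; have [] := So_resolvent_uniq phi_contr H_rkhs (@Cplus1 R) h (hB u).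
    by rewrite !scale1r !subrr.
  by [].
have B_lin : linear B.
  move=> a u v; apply/esym/(B_uniq _ _ (a *: phi 1 u + phi 1 v)).
  have := So_eqP H_rkhs a (hB u) (hB v); by rewrite !scale1r.
have B_contr u : hn (B u) <= 1 * hn u.
  have := So_dissipative phi_contr H_rkhs (hB u); rewrite scale1r Re_ip mul1r => h.
  rewrite -ler_sqr ?nnegrE ?hn_ge0 //.
  have := sqr_ge0 (hn (phi 1 u)); have := sqr_ge0 (hn (B u)); lra.
have E_lin : linear (fun x => J x - x).
  by move=> a x y; rewrite J_linear; hilbert_ring.
have E_bound x : hn (J x - x) <= 2 * hn x.
  have := hnB (J x) x; have := So_main_bound phi_contr H_rkhs (@Cplus1 R) (JP x).
  by rewrite /= invr1 mul1r scale1r subKr; lra.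
have main_shift x u z y : So x u z y -> A (x - B u, z - B u).
  move=> h; apply/AP; exists (y - phi 1 u).
  by have := So_eqB H_rkhs h (hB u); rewrite subrr scale1r.
have EB x u z y : S ((x, u), (z, y)) -> (J x - x) + B u = J z.
  move=> /SoP/main_shift/JK h.
  have -> : J z = J x - (J (x - z)).
    by have := J_linear (-1) z x; rewrite !scaleN1r ![- _ + _]addrC => ->; rewrite subKr.
  have -> : x - z = x - B u - (z - B u) by hilbert_ring.
  by rewrite h; hilbert_ring.
have domE : dom S = [set v | exists z, (J v.1 - v.1) + B v.2 = J z].
  rewrite predeqE => -[x u]; split=> [[[z y] h]|[z /= h]].
    by exists z; exact: EB h.
  have /AP[y hy] := JP (x - z).
  have e : J (x - z) + B u = x.
    have -> : J (x - z) = J x - J z.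
      by have := J_linear (-1) z x; rewrite !scaleN1r ![- _ + _]addrC.
    by rewrite -h; hilbert_ring.
  exists (J (x - z) - (x - z) + B u, y + phi 1 u); apply/SoP.
  have := So_eqP H_rkhs 1 hy (hB u); rewrite !scale1r add0r e.
  by [].
pose E := @NodeExt R U H Y S rg (linear_pack E_lin) (linear_pack B_lin)
  (bounded_linear_continuous (f := linear_pack E_lin) E_bound)
  (bounded_linear_continuous (f := linear_pack B_lin) B_contr) EB domE.
exists rg, E => m u hm; have [b hb'] := So_control u hm.
have resE : ext_resolvent E m (ext_B E u) = b.
  have eb := EB _ _ _ _ ((SoP _ _ _ _).2 hb').
  rewrite /ext_resolvent; case: xgetP => [x _ /= ex|/(_ b)/= []]; last first.
    rewrite -[B u](addKr (J b - b)) eb.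
    have := J_linear m b 0; rewrite addr0 => ->.
    have -> : J 0 = 0 by have := J_linear (-1) 0 0; rewrite scaler0 addr0 scaleN1r addNr.
    by rewrite addr0 addrC.
  (* Two solutions differ by some [x - b] for which [J (x - b)] is an eigenvector of [A] at [m] or
     zero; [So_eq_inj] excludes the former. *)
  have [y hy] : exists y, So (J (x - b)) 0 (m *: J (x - b)) y.
    have := JP (x - b); suff -> : J (x - b) - (x - b) = m *: J (x - b) by move=> /AP.
    have JB : J (x - b) = J x - J b.
      by have := J_linear (-1) b x; rewrite !scaleN1r ![- _ + _]addrC.
    have Jm : J (m *: b) = m *: J b.
      have := J_linear m b 0; rewrite addr0 => ->.
      have -> : J 0 = 0 by have := J_linear (-1) 0 0; rewrite scaler0 addr0 scaleN1r addNr.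
      by rewrite addr0.
    rewrite Jm in eb; rewrite JB.
    have : (m *: J x - (J x - x)) - B u = 0 by rewrite ex subrr.
    have : (J b - b) + B u - m *: J b = 0 by rewrite eb subrr.
    move=> h1 h2; apply/eqP; rewrite -subr_eq0; apply/eqP; rewrite -[RHS]oppr0.
    rewrite -[in RHS](addr0 0) -{1}h1 -h2; hilbert_ring.
  have J0 := So_eq_inj phi_contr H_rkhs hm hy.
  have := JP (x - b); rewrite J0 sub0r => /(So_main_fun phi_contr H_rkhs) /eqP.
  by rewrite oppr_eq0 subr_eq0 => /eqP.
rewrite /transfer_function resE /CD_row.
case: xgetP => [y _ /= [z /SoP h]|/(_ (phi m u))/= []]; last first.
  by exists (m *: b); apply/SoP.
by have [->] := So_eq_uniq phi_contr H_rkhs h hb'.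
Qed.

Lemma So_system_node : system_node S.
Proof.
split.
- exact: (So_linear_op phi_contr H_rkhs).
- exact: (So_closed phi_contr H_rkhs).
- exact: (So_generates phi_contr H_rkhs).
- by have [rg' [E _]] := model_rigging; exists rg'; split.
Qed.

Lemma So_realization : realization S phi.
Proof.
have [rg' [E h]] := model_rigging; exists rg', E, 0; split=> [m hm|m hm u].
  by split=> //; exact: (So_res phi_contr H_rkhs).
exact: h.
Qed.

(** In the model [C (m - A)^-1] is evaluation at [m]. *)
Lemma So_observable : observable S.
Proof.
move=> x hx; apply: (rkhs_ext H_rkhs) => m hm; rewrite (ev0 H_rkhs) //.
have hres := So_res phi_contr H_rkhs hm.
have [z /=] := hx m (Cplus_rho_infty (fun l => @So_res _ _ _ _ _ _ phi_contr H_rkhs l) hm).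
have [z' Az e] := resolventP x hres; move/SoP => h.
have /AP[y h'] := Az; have [_ zz] := So_eq_uniq phi_contr H_rkhs h h'.
rewrite -e (evB H_rkhs) // (evZ H_rkhs) // -zz (h m hm).
by rewrite linear0 addr0 subr0 subrr.
Qed.

End ModelRigging.

(** * Determination of model functions by their values on a half-plane *)

Section ModelHalfPlane.
Variables (R : realType) (U Y H : hilbertType R).
Variables (phi : R[i] -> {linear U -> Y}) (ev : H -> R[i] -> Y).
Hypothesis phi_contr : forall l, Cplus l -> forall u, hn (phi l u) <= hn u.
Hypothesis H_rkhs : is_RKHS ev (K_o phi).
Variable w : R.
Hypothesis w0 : 0 <= w.
Implicit Types (l m : R[i]) (x z f : H) (u : U) (y : Y).

Local Notation So := (So_eq phi ev).
Local Notation A := (main_op (S_o phi ev)).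
Local Notation AP := (So_main phi_contr H_rkhs).

Let halfC l : w < Re l -> Cplus l.
Proof. by move=> h; exact: le_lt_trans w0 h. Qed.

(* If [f] vanishes on the half-plane, so does [(r - A)^-1 f] for large [r], hence
   also [(m - A)^-1 f] for every [m] in [C^+], and this forces [f m = 0]. *)
Lemma ev_half_plane0 f : (forall l, w < Re l -> ev f l = 0) -> f = 0.
Proof.
move=> f0; apply: (rkhs_ext H_rkhs) => m hm; rewrite (ev0 H_rkhs) //.
pose G := [set k : H | exists l y, w < Re l /\ k = rkernel phi ev l y].
have GP g : annihilator G g <-> forall l, w < Re l -> ev g l = 0.
  split=> [h l hl|h _ [l [y [hl ->]]]].
    apply: ip_inj => y; rewrite ip0l -(ip_rkernel H_rkhs) ?h //; last exact: halfC.
    by exists l, y.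
  by rewrite (ip_rkernel H_rkhs) ?h ?ip0l //; exact: halfC.
have mp : 0 < Re m := hm.
(* The resolvent bound at [r] is [1 / r], so [|r - m| < r] is needed, that is
   [r > |m|^2 / (2 Re m)]. The summands [w] and 1 in [r] put it in the half-plane. *)
pose q := (Re m ^+ 2 + Im m ^+ 2) / Re m.
have q0 : 0 <= q by rewrite divr_ge0 ?addr_ge0 ?sqr_ge0 // ltW.
pose r := w + q + 1; have r0 : 0 < r by rewrite ltr_wpDl ?addr_ge0.
have wr : w < Re r%:C by rewrite /= /r; lra.
have rC : Cplus (r%:C : R[i]) := r0.
have [x [z [Axz xz]]] := So_main_range phi_contr H_rkhs f hm.
have inv x' z' : A (x', z') -> annihilator G (r%:C *: x' - z') -> annihilator G x'.
  move=> /AP[y h] /GP g0; have eE l : w < Re l ->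
      (r%:C - l) *: ev x' l + y = 0.
    move=> hl; have := g0 l hl; rewrite (evB H_rkhs) ?(evZ H_rkhs) ?h //; try exact: halfC.
    rewrite linear0 addr0 => <-; hilbert_ring.
  have y0 : y = 0 by have := eE _ wr; rewrite subrr scale0r add0r.
  have x0 l : w < Re l -> l != r%:C -> ev x' l = 0.
    move=> hl lr; have /eqP := eE _ hl.
    by rewrite y0 addr0 scaler_eq0 subr_eq0 eq_sym (negbTE lr) => /eqP.
  apply/GP => l hl; have [->|] := eqVneq l r%:C; last exact: x0.
  exact: (ev_punctured0 phi_contr H_rkhs w0).
have Gx : annihilator G x.
  apply: (resolvent_invariance (m := m) (So_main_subspace phi_contr H_rkhs)
    (fun f => So_main_range phi_contr H_rkhs f rC)
    (fun x z => @So_main_bound _ _ _ _ _ _ phi_contr H_rkhs r%:C x z rC) inv _ Axz).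
    rewrite ltr_pdivrMr // mul1r -ltr_sqr ?nnegrE ?Re_norm_ge0 ?(ltW rC) //.
    rewrite Re_normB_sqr /= sub0r sqrrN; have : q * Re m = Re m ^+ 2 + Im m ^+ 2 by rewrite divfK // gt_eqF.
    have : 0 <= w * Re m by rewrite mulr_ge0 // ltW.
    have : 0 <= q * Re m by rewrite mulr_ge0 // ltW.
    move=> h1 h2 h3; suff : 0 < r ^+ 2 - ((r - Re m) ^+ 2 + Im m ^+ 2).
      by rewrite subr_gt0.
    have -> : r ^+ 2 - ((r - Re m) ^+ 2 + Im m ^+ 2) =
      2 * (w * Re m) + q * Re m + 2 * Re m + (q * Re m - (Re m ^+ 2 + Im m ^+ 2)).
      by rewrite /r; ring.
    by rewrite h3 subrr addr0; lra.
  by rewrite xz; apply/GP.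
have /AP[y h] := Axz; have /GP x0 := Gx.
have fE l : Cplus l -> ev f l = (m - l) *: ev x l + y.
  move=> hl; rewrite -xz (evB H_rkhs) // (evZ H_rkhs) // (h l hl) linear0 addr0.
  by hilbert_ring.
have y0 : y = 0 by have := fE _ rC; rewrite f0 // x0 // scaler0 add0r.
by rewrite fE // subrr scale0r add0r.
Qed.

(** Compare with the model solution of the same resolvent equation at [a]: the difference vanishes
    on the half-plane, hence everywhere. *)
Lemma So_eq_half_plane x u z y :
  (forall m, w < Re m -> ev z m = m *: ev x m + phi m u - y) -> So x u z y.
Proof.
move=> h; pose a := (w + 1)%:C : R[i].
have wa : w < Re a by rewrite /= ltrDl ltr01.
have [x' [z' [y' [h' e _]]]] :=
  So_resolvent phi_contr H_rkhs (a *: x - z) u (halfC wa).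
have zz : z - z' = a *: (x - x').
  have -> : z - z' = a *: (x - x') - ((a *: x - z) - (a *: x' - z')) by hilbert_ring.
  by rewrite e subrr subr0.
have dE m : w < Re m -> (a - m) *: ev (x - x') m = y' - y.
  move=> hm; have hC := halfC hm; have := congr1 (ev^~ m) zz => /=.
  rewrite (evZ H_rkhs) // (evB H_rkhs) // (h m hm) (h' m hC) => e1.
  rewrite scalerBl -e1 (evB H_rkhs) //; hilbert_ring.
have yy : y' = y.
  by have := dE _ wa; rewrite subrr scale0r => /esym/eqP; rewrite subr_eq0 => /eqP.
have d0 : x - x' = 0.
  have d1 m : w < Re m -> m != a -> ev (x - x') m = 0.
    move=> hm ma; have /eqP := dE _ hm.
    by rewrite yy subrr scaler_eq0 subr_eq0 eq_sym (negbTE ma) => /eqP.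
  apply: ev_half_plane0 => m hm; have [->|] := eqVneq m a; last exact: d1.
  exact: (ev_punctured0 phi_contr H_rkhs w0).
have -> : x = x' by apply/eqP; rewrite -subr_eq0 d0.
move: zz; rewrite d0 scaler0 => /eqP; rewrite subr_eq0 => /eqP ->.
by rewrite -yy.
Qed.

End ModelHalfPlane.

(** * Operators with a rigging *)

Section ResolventComponent.
Variables (R : realType) (X : hilbertType R) (A : set (X * X)) (G : set X).
Hypothesis A_sub : subspace A.
Implicit Types (l m n : R[i]) (K : R).

Let bound l K := forall x z, A (x, z) -> hn x <= K * hn (l *: x - z).
Let inv l := forall x z, A (x, z) -> annihilator G (l *: x - z) -> annihilator G x.

Let disks_open (P : R[i] -> R -> Prop) (O : set R[i]) :
  (forall m, O m <-> exists l K, [/\ 0 < K, P l K & Re `|l - m| * K < 1]) ->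
  open (O : set R[i]^o).
Proof.
move=> OE; rewrite openE => m /OE[l [K [K0 Pl lm]]].
apply/nbhs_ballP; exists ((1 - Re `|l - m| * K) / K)%:C => /=.
  by rewrite ltcR divr_gt0 // subr_gt0.
move=> n; rewrite -ball_normE /= => mn.
have {}mn : Re `|m - n| < (1 - Re `|l - m| * K) / K.
  by rewrite -ltcR -ge0_ReE ?normr_ge0.
apply/OE; exists l, K; split=> //.
rewrite ltr_pdivlMr // in mn.
have : Re `|l - n| <= Re `|l - m| + Re `|m - n|.
  exact: (@hn_tri R R[i]^o m l n).
nra.
Qed.

Let inv_near l m K : res A l -> bound l K -> inv l -> Re `|l - m| * K < 1 -> inv m.
Proof.
move=> hl lK il lm x z; apply: (resolvent_invariance A_sub _ lK il lm).
by move=> f; have [z' h1 h2] := resolventP f hl; exists (resolvent A l f), z'.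
Qed.

Let res_pos_bound l : res A l -> exists2 K, 0 < K & bound l K.
Proof.
move=> /res_bound[K [K0 hK]]; exists (K + 1) => [|x z /hK h]; first by lra.
by apply: le_trans h _; rewrite ler_wpM2r ?hn_ge0 //; lra.
Qed.

(* The set of [l] in the resolvent set for which [(l - A)^-1] leaves the
   annihilator invariant is open and relatively closed. *)
Lemma resolvent_invariance_connected (K : set R[i]) l :
  connected (K : set R[i]^o) -> K `<=` res A -> K l ->
  (forall x z, A (x, z) -> annihilator G (l *: x - z) -> annihilator G x) ->
  forall m, K m -> forall x z, A (x, z) -> annihilator G (m *: x - z) -> annihilator G x.
Proof.
move=> Kc Kres Kl il m Km.
suff KE : K `&` inv = K by move: Km; rewrite -{1}KE => -[_].
apply: Kc; first by exists l.
- pose O := [set m | exists l k, [/\ 0 < k, [/\ K l, inv l & bound l k] & Re `|l - m| * k < 1]].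
  exists O; first by apply: (@disks_open (fun l k => [/\ K l, inv l & bound l k])).
  rewrite predeqE => n; split=> [[Kn In]|[Kn [l' [k [k0 [Kl' Il' bl] h]]]]].
    split=> //; have [k k0 bk] := res_pos_bound (Kres _ Kn).
    by exists n, k; split=> //; rewrite subrr normr0 mul0r.
  by split=> //; exact: inv_near (Kres _ Kl') bl Il' h.
(* The bound [k / 2] at [l] becomes [k] at any [n] of the disk [|l - n| k < 1], so invariance at
   such an [n] would pass back to [l]. *)
pose O := [set m | exists l k, [/\ 0 < k,
  [/\ K l, ~ inv l & bound l (k / 2)] & Re `|l - m| * k < 1]].
have oO : open (O : set R[i]^o).
  by apply: (@disks_open (fun l k => [/\ K l, ~ inv l & bound l (k / 2)])).
exists (~` O); first exact: open_closedC.
rewrite predeqE => n; split=> [[Kn In]|[Kn nO]]; split=> //.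
  move=> [l' [k [k0 [Kl' Il' bl] h]]]; apply: Il'.
  apply: (inv_near (l := n) (K := k) (Kres _ Kn) _ In); last first.
    by rewrite -normrN opprB.
  move=> x z Axz; have := bl x z Axz.
  have -> : l' *: x - z = (n *: x - z) + (l' - n) *: x by hilbert_ring.
  have := hnD (n *: x - z) ((l' - n) *: x); rewrite hnZ.
  have := hn_ge0 x; have := hn_ge0 (n *: x - z).
  set a := hn x; set b := hn (n *: x - z); set c := hn (_ + _); set d := Re _ in h *.
  move=> b0 a0 h1 h2.
  have h3 : k / 2 * c <= k / 2 * (b + d * a) by rewrite ler_wpM2l //; lra.
  have h4 : d * k * a <= a by rewrite -[leRHS]mul1r ler_wpM2r // ltW.
  lra.
apply: contrapT => nI; apply: nO; have [k k0 bk] := res_pos_bound (Kres _ Kn).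
exists n, (k * 2); split; first by lra.
  by split=> //; rewrite mulfK ?pnatr_eq0.
by rewrite subrr normr0 mul0r.
Qed.

End ResolventComponent.

(* If the embedded [a_n] converge to [v], then the [(m - A)^-1 a_n] are Cauchy,
   since [|(m - A)^-1 a|] is at most a multiple of the norm of [a] in [X_{-1}]. *)
Lemma ext_resolvent_exists (R : realType) (U X Y : hilbertType R)
    (S : set ((X * U) * (X * Y))) (rg : rigging (main_op S)) (E : node_ext rg)
    (m : R[i]) (v : rig_space rg) :
  subspace (main_op S) -> res (main_op S) m ->
  exists x, m *: rig_emb rg x - ext_A E x = v.
Proof.
set A := main_op S => A_sub hm.
have hb := rig_beta_res rg; set b := rig_beta rg in hb.
have embE x z : A (x, z) -> hn (rig_emb rg (b *: x - z)) = hn x.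
  by move=> Axz; rewrite /hn rig_norm resolventK.
have [Kb [Kb0 hKb]] := res_bound hb; have [Km [Km0 hKm]] := res_bound hm.
have emb_bound x : hn (rig_emb rg x) <= Kb * hn x.
  have [z Az e] := resolventP x hb.
  by rewrite -{1}e (embE _ _ Az); apply: le_trans (hKb _ _ Az) _; rewrite e.
have emb_cont := bounded_linear_continuous emb_bound.
pose C := 1 + Re `|b - m| * Km; have C0 : 0 < C.
  by rewrite ltr_pwDl // mulr_ge0 // Re_norm_ge0.
(* Resolvent identity: with [x'] the solution at [b], [m - A] maps [x - x'] to [(b - m) *: x'], and
   [|x'|] is the norm of the right-hand side in [X_{-1}]. *)
have compare x z : A (x, z) -> hn x <= C * hn (rig_emb rg (m *: x - z)).
  move=> Axz; set a := m *: x - z; have [z' Az e] := resolventP a hb.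
  set x' := resolvent _ _ _ in Az e.
  rewrite -e (embE _ _ Az).
  have Ad := A_sub.2 (-1) _ _ Az Axz.
  have := hKm _ _ Ad.
  have -> : m *: (-1 *: x' + x) - (-1 *: z' + z) = (b - m) *: x'.
    have -> : m *: (-1 *: x' + x) - (-1 *: z' + z) = a - (b *: x' - z') + (b - m) *: x'.
      by rewrite /a; hilbert_ring.
    by rewrite e subrr add0r.
  rewrite hnZ => h; have -> : x = (-1 *: x' + x) + x' by hilbert_ring.
  apply: le_trans (hnD _ _) _; rewrite /C; lra.
have dns := (dense_hnP _).1 (@rig_dense _ _ _ rg).
have /choice[a ha] : forall n, exists a : X, hn (v - rig_emb rg a) < n.+1%:R^-1.
  move=> n; have [|_ [a _ <-] h] := dns v n.+1%:R^-1; first by rewrite invr_gt0 ltr0n.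
  by exists a.
pose x n := resolvent A m (a n).
have xP n : A (x n, m *: x n - a n).
  by have [z Az e] := resolventP (a n) hm; rewrite -{1}e subKr.
have inv_lt (e : R) : 0 < e -> exists N, forall n, (N <= n)%N -> n.+1%:R^-1 < e.
  move=> e0; exists (Num.truncn e^-1) => n hn'.
  rewrite -[e]invrK ltf_pV2 ?posrE ?ltr0n ?invr_gt0 //.
  by apply: lt_le_trans (truncnS_gt _) _; rewrite ler_nat ltnS.
have av (e : R) : 0 < e -> exists N, forall n, (N <= n)%N -> hn (v - rig_emb rg (a n)) < e.
  by move=> /inv_lt[N hN]; exists N => n /hN; exact: lt_trans.
have [|x0 x0P] := @complete_hn R X x.
  move=> e e0; have [|N hN] := av (e / 2 / C); first by rewrite !divr_gt0.
  exists N => i j /hN hi /hN hj.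
  have Ad := A_sub.2 (-1) _ _ (xP j) (xP i).
  have -> : x i - x j = -1 *: x j + x i by rewrite scaleN1r addrC.
  apply: le_lt_trans (compare _ _ Ad) _.
  have -> : m *: (-1 *: x j + x i) - (-1 *: (m *: x j - a j) + (m *: x i - a i)) =
     a i - a j by hilbert_ring.
  rewrite linearB /=.
  have -> : rig_emb rg (a i) - rig_emb rg (a j) =
    (v - rig_emb rg (a j)) - (v - rig_emb rg (a i)) by rewrite opprB [RHS]addrC addrA subrK.
  have := hnB (v - rig_emb rg (a j)) (v - rig_emb rg (a i)).
  move: hi hj; rewrite !ltr_pdivlMr //; nra.
exists x0; apply/eqP; rewrite -subr_eq0; apply/eqP/hn_le0.
have gE n : m *: rig_emb rg (x n) - ext_A E (x n) = rig_emb rg (a n).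
  have [y hy] := xP n; have := ext_AB E hy; rewrite linear0 addr0 => ->.
  by rewrite linearB linearZ /= subKr.
have gc : (fun n => m *: rig_emb rg (x n) - ext_A E (x n)) @ \oo -->
    m *: rig_emb rg x0 - ext_A E x0.
  apply: cvgB; last by apply: (cvg_comp _ _ x0P); exact: ext_A_continuous.
  by apply: cvgZr; apply: (cvg_comp _ _ x0P); exact: emb_cont.
apply: (lim_hn_le gc) => e /av[N hN]; exists N => n /hN.
by rewrite add0r gE hnBC => /ltW.
Qed.

(** * Uniqueness *)

Section Uniqueness.
Variables (R : realType) (U Y X : hilbertType R).
Variable phi : R[i] -> {linear U -> Y}.
Hypothesis phi_contr : forall l, Cplus l -> forall u, hn (phi l u) <= hn u.
Variable S : set ((X * U) * (X * Y)).
Hypothesis S_node : system_node S.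
Hypothesis S_coenergy : co_energy_preserving S.
Variable w : R.
Hypothesis w_res : half_plane w `<=` res (main_op S) `&` @Cplus R.
Hypothesis S_control : forall l, w < Re l -> forall u,
  exists b, S ((b, u), (l *: b, phi l u)).
Implicit Types (l m : R[i]) (x z e : X) (u : U) (y : Y).

Local Notation A := (main_op S).

Let Cp l : w < Re l -> Cplus l. Proof. by move=> /w_res[]. Qed.
Let rs l : w < Re l -> res A l. Proof. by move=> /w_res[]. Qed.

Let S_pair a x u z y x' u' z' y' : S ((x, u), (z, y)) -> S ((x', u'), (z', y')) ->
  S ((a *: x + x', a *: u + u'), (a *: z + z', a *: y + y')).
Proof. by case: S_node => -[_ h _] _ _ _; exact: (h a (_, _) (_, _)). Qed.

Lemma node_pairB x u z y x' u' z' y' : S ((x, u), (z, y)) -> S ((x', u'), (z', y')) ->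
  S ((x - x', u - u'), (z - z', y - y')).
Proof.
by move=> h h'; have := S_pair (-1) h' h; rewrite !scaleN1r ![- _ + _]addrC.
Qed.

Lemma node_zero z y : S ((0, 0), (z, y)) -> z = 0 /\ y = 0.
Proof.
case: S_node => -[S0 _ Sf] _ _ _ h.
by have [-> ->] : (z, y) = (0, 0) by exact: Sf h S0.
Qed.

Lemma node_main_subspace : subspace A.
Proof.
split; first by exists 0; case: S_node => -[].
move=> a [x z] [x' z'] [y h] [y' h']; exists (a *: y + y').
by have := S_pair a h h'; rewrite scaler0 addr0.
Qed.

(* [e = (C (l - A)^-1)^* y], with [C] and [A] read off [S]. *)
Definition obs_adj l y e := forall r z c, S ((r, 0), (z, c)) ->
  ip c y = ip (l *: r - z) e.

(** Subtracting the control pair of [u] reduces the adjoint condition to elements of [S] with zero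
    input. *)
Lemma obs_adj_adjoint l y e : w < Re l -> obs_adj l y e ->
  adjoint_op S ((e, y), (conjc l *: e, adj (phi l) y)).
Proof.
move=> hl he [x u] [z c] h; rewrite /ip2 /=.
have [b hb'] := S_control hl u; have := node_pairB h hb'; rewrite subrr => /he.
have -> : l *: (x - b) - (z - l *: b) = l *: x - z by hilbert_ring.
rewrite ipBl (schur_adjP phi_contr) ?ipBl ?ipZl ?ipZr ?conjcKE; last exact: Cp.
move=> e1; apply/eqP; rewrite -subr_eq0; apply/eqP.
apply: (@etrans _ _ ((ip c y - ip u (adj (phi l) y)) - (l * ip x e - ip z e))).
  by ring.
by rewrite e1 subrr.
Qed.

Let energy (p q : (X * Y) * (X * U)) : R[i] :=
  ip p.2.1 q.1.1 + ip p.1.1 q.2.1 - ip p.1.2 q.1.2 + ip p.2.2 q.2.2.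

Let energy0 p q : adjoint_op S p -> adjoint_op S q -> energy p q = 0.
Proof.
apply: polarization0 => [|a x y z|a x y z|[[x y] [z u]] /S_coenergy].
- split=> [v w' _|a x y hx hy v w' h]; first by rewrite /ip2 /= !ip0r addr0.
  have := hx _ _ h; have := hy _ _ h; rewrite /ip2 /= !ipDr !ipZr => e1 e2.
  rewrite addrACA -mulrDr e2 mulrDr e1; ring.
- by rewrite /energy /= !ipDl !ipZl; ring.
- by rewrite /energy /= !ipDr !ipZr; ring.
by rewrite /energy /= !ip_norm => ->; ring.
Qed.

Lemma obs_adj_gram l m y y' e e' : w < Re l -> w < Re m ->
  obs_adj l y e -> obs_adj m y' e' ->
  (conjc l + m) * ip e e' = ip y y' - ip (adj (phi l) y) (adj (phi m) y').
Proof.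
move=> hl hm he he'.
have := energy0 (obs_adj_adjoint hl he) (obs_adj_adjoint hm he').
rewrite /energy /= ipZl ipZr conjcKE => h; apply/eqP; rewrite -subr_eq0 -h.
by apply/eqP; ring.
Qed.

Let Re_gt0 l : w < Re l -> 0 < Re l. Proof. exact: Cp. Qed.

Lemma obs_adj_bound l y e : w < Re l -> obs_adj l y e ->
  2 * Re l * hn e ^+ 2 <= hn y ^+ 2.
Proof.
move=> hl he; have := congr1 (@complex.Re R) (obs_adj_gram hl hl he he).
have -> : conjc l + l = (2 * Re l)%:C.
  by apply: complex_eqP; case: (l) => a b /=; ring.
rewrite ReZ ReB !Re_ip => ->.
by have := sqr_ge0 (hn (adj (phi l) y)); lra.
Qed.

(* The graph of [C (l - A)^-1], an everywhere defined closed operator. *)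
Let graph l : set (X * Y) := [set p | exists r z, S ((r, 0), (z, p.2)) /\ l *: r - z = p.1].

Let graph_subspace l : subspace (graph l).
Proof.
split=> [|a [v c] [v' c'] [r [z [h e]]] [r' [z' [h' e']]]].
  exists 0, 0; split; last by rewrite scaler0 subrr.
  by case: S_node => -[].
exists (a *: r + r'), (a *: z + z'); split=> /=.
  by have := S_pair a h h'; rewrite scaler0 addr0.
by rewrite /= in e e'; rewrite -e -e'; hilbert_ring.
Qed.

(** A closed operator has a densely defined adjoint: if [g] is orthogonal to its domain, then
    [(0, g)] is a limit of graph elements. Closedness of [S] then gives [g = 0]. *)
Lemma obs_adj_dense l y (d : R) : w < Re l -> 0 < d ->
  exists y' e, obs_adj l y' e /\ hn (y - y') < d.
Proof.
move=> hl d0.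
have [||y' [e he] hy] := @orthogonal_dense R Y [set y' | exists e, obs_adj l y' e] _ _ y d d0.
- split=> [|a y1 y2 [e1 h1] [e2 h2]].
    by exists 0 => r z c _; rewrite !ip0r.
  exists (a *: e1 + e2) => r z c h.
  by rewrite !ipDr !ipZr (h1 _ _ _ h) (h2 _ _ _ h).
- move=> g hg.
  pose b := hform_sum (hform_ip X) (hform_ip Y) (@ltr01 R).
  have bi : forall e : R, 0 < e -> exists2 p, graph l p &
      Re (b (p - (0, g)) (p - (0, g))) < e.
    apply: bi_annihilator => // -[e y'] he.
    (* Orthogonality of [(e, y')] to the graph says that the two inner products add up to zero,
       hence the sign. *)
    have hy : obs_adj l y' (- e).
      move=> r z c h; have : b (l *: r - z, c) (e, y') = 0.
        by apply: he; exists r, z.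
      rewrite /= mul1r => /eqP; rewrite addr_eq0 => /eqP h2.
      by rewrite ipNr h2 opprK.
    rewrite /= ip0l add0r mul1r ip_conj (hg y') ?conjc0 //.
    by exists (- e).
  have [K [K0 hK]] := res_bound (rs hl).
  have [_ Scl _ _] := S_node; move/closed_hnP: Scl => Scl.
  have : S ((0, 0), (0, g)).
    apply: Scl => e e0.
    have l0 := Re_norm_ge0 l.
    pose M := Re `|l| * K + K + 2; have M0 : 0 < M.
      by rewrite ltr_wpDl // addr_ge0 // mulr_ge0.
    have eM : 0 < e / M by rewrite divr_gt0.
    have [|[v c] [r [z [/= h rz]]] hvc] := bi ((e / M) ^+ 2).
      by rewrite exprn_gt0.
    move: hvc; rewrite /= subr0 mul1r ReD !Re_ip => hvc.
    have hv : hn v < e / M.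
      by rewrite -hn_lt_sqr //; apply: le_lt_trans hvc; rewrite lerDl sqr_ge0.
    have hc : hn (c - g) < e / M.
      by rewrite -hn_lt_sqr //; apply: le_lt_trans hvc; rewrite lerDr sqr_ge0.
    have hr : hn r <= K * hn v by rewrite -rz; apply: hK; exists c.
    have hz : hn z <= Re `|l| * hn r + hn v.
      have -> : z = l *: r - v by rewrite -rz subKr.
      by apply: le_trans (hnB _ _) _; rewrite hnZ.
    have Me : M * (e / M) = e by rewrite mulrC divfK // gt_eqF.
    move: eM hv hc Me; set t := e / M; move: t => t eM hv hc Me.
    have h1 : K * hn v <= K * t by rewrite ler_wpM2l // ltW.
    have h2 : Re `|l| * hn r <= Re `|l| * (K * t).
      by rewrite ler_wpM2l //; apply: le_trans hr h1.
    have h3 : 0 <= Re `|l| * (K * t) by rewrite !mulr_ge0 // ltW.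
    have h4 : 0 <= K * t by rewrite !mulr_ge0 // ltW.
    have Me' : Re `|l| * (K * t) + K * t + 2 * t = e.
      by rewrite -[RHS]Me /M; ring.
    exists ((r, 0), (z, c)) => //.
    apply/hn_pair_lt; split; apply/hn_pair_lt; split=> /=.
    + by rewrite sub0r hnN; lra.
    + by rewrite subrr hn0.
    + by rewrite sub0r hnN; lra.
    + by rewrite hnBC; lra.
  by move=> /node_zero[].
by exists y', e.
Qed.

(** The Gram identity bounds [|e|] by [k |y'|] on the dense set of [y'] already served. This bounds
    [C (l - A)^-1], so [riesz] serves every [y]. *)
Lemma obs_adj_exists l y : w < Re l -> exists e, obs_adj l y e.
Proof.
move=> hl; have lp := Re_gt0 hl.
pose k := Num.sqrt (2 * Re l)^-1; have k0 : 0 <= k by rewrite sqrtr_ge0.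
have kb y' e' : obs_adj l y' e' -> hn e' <= k * hn y'.
  move=> /(obs_adj_bound hl) h.
  rewrite -ler_sqr ?nnegrE ?mulr_ge0 ?hn_ge0 // exprMn sqr_sqrtr.
    by rewrite [leRHS]mulrC ler_pdivlMr ?mulr_gt0 // mulrC.
  by rewrite invr_ge0 mulr_ge0 // ltW.
have half v c : graph l (v, c) -> Re (ip c y) <= k * hn v * hn y.
  move=> [r [z [/= h rz]]]; rewrite -subr_le0; apply: le0_eps => e e0.
  have v0 := hn_ge0 v; have c0 := hn_ge0 c.
  pose M := k * hn v + hn c + 1; have M0 : 0 < M by rewrite ltr_wpDl // addr_ge0 // mulr_ge0.
  have [|y' [e' [he' hy]]] := @obs_adj_dense l y (e / M) hl.
    by rewrite divr_gt0.
  have -> : ip c y = ip v e' + ip c (y - y').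
    by rewrite ipBr (he' _ _ _ h) rz addrC subrK.
  rewrite ReD; have h1 := Re_ip_le v e'; have h2 := Re_ip_le c (y - y').
  have h3 : hn v * hn e' <= hn v * (k * hn y') by rewrite ler_wpM2l // kb.
  have h4 : hn y' <= hn y + hn (y - y').
    by have := hnB y (y - y'); rewrite subKr.
  have h5 : k * hn v * hn y' <= k * hn v * (hn y + hn (y - y')).
    by rewrite ler_wpM2l // mulr_ge0.
  rewrite ltr_pdivlMr // in hy; have y0 := hn_ge0 (y - y').
  have h6 : hn (y - y') * (k * hn v + hn c) <= e.
    by apply: le_trans (ltW hy); rewrite ler_wpM2l // /M; lra.
  lra.
have [|a d c d' c' [c1 [g1 ->]] [c2 [g2 ->]]|d c [c1 [g1 ->]]||e [eL _ _]] :=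
  @riesz R X (hform_ip X) (fun v c0 => exists c, graph l (v, c) /\ c0 = ip c y)
    (k ^+ 2 * hn y ^+ 2).
- by exists 0; rewrite ip0l; split=> //; exact: (graph_subspace l).1.
- exists (a *: c1 + c2); split; last by rewrite ipDl ipZl.
  exact: (graph_subspace l).2 a (_, _) (_, _) g1 g2.
- have h1 := half _ _ g1.
  have gN : graph l (- d, - c1).
    have := (graph_subspace l).2 (-1) _ _ g1 (graph_subspace l).1.
    by rewrite addr0 scaleN1r.
  have := half _ _ gN; rewrite hnN ipNl ReN => h2.
  rewrite /= Re_ip -[leLHS]real_normK ?num_real //.
  have -> : k ^+ 2 * hn y ^+ 2 * hn d ^+ 2 = (k * hn d * hn y) ^+ 2 by ring.
  rewrite ler_sqr ?nnegrE ?mulr_ge0 ?hn_ge0 //.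
  by rewrite ler_norml h1 andbT lerNl.
- by rewrite mulr_ge0 ?sqr_ge0.
by exists e => r z c h; apply: eL; exists c; split=> //; exists r, z.
Qed.

Hypothesis S_obs : observable S.

Lemma obs_adj_total (e : R[i] -> Y -> X) :
  (forall l y, w < Re l -> obs_adj l y (e l y)) ->
  forall x, (forall l y, w < Re l -> ip (e l y) x = 0) -> x = 0.
Proof.
move=> eP x0 x0e.
pose G := [set k : X | exists l y, w < Re l /\ k = e l y].
have GP g : annihilator G g <-> forall l y, w < Re l -> ip (e l y) g = 0.
  split=> [h l y hl|h _ [l [y [hl ->]]]].
    by rewrite ip_conj h ?conjc0 //; exists l, y.
  by rewrite ip_conj h ?conjc0.
have GS := annihilator_subspace G.
have main_ann l x z : w < Re l -> A (x, z) -> annihilator G (l *: x - z) ->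
    S ((x, 0), (z, 0)).
  move=> hl [c h] g0; suff <- : c = 0 by [].
  apply: ip_inj => y; rewrite ip0l (eP l y hl _ _ _ h) ip_conj.
  by rewrite (GP _).1 ?conjc0.
have inv l : w < Re l -> forall x z, A (x, z) -> annihilator G (l *: x - z) ->
    annihilator G x.
  move=> hl x z Axz g0; have h := main_ann l x z hl Axz g0.
  (* Here [C x = 0], and [m *: x - z] equals [(m - l) *: x] up to an element of the annihilator. *)
  have ne m y : w < Re m -> m != l -> ip (e m y) x = 0.
    move=> hm ml; have := eP m y hm _ _ _ h; rewrite ip0l.
    have -> : m *: x - z = (l *: x - z) + (m - l) *: x by hilbert_ring.
    rewrite ipDl ipZl [ip (l *: x - z) _]ip_conj (GP _).1 // conjc0 add0r.
    move/esym/eqP; rewrite mulf_eq0 subr_eq0 (negbTE ml) => /eqP h1.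
    by rewrite ip_conj h1 conjc0.
  apply/GP => m y hm; have [->|] := eqVneq m l; last exact: ne.
  apply: (gram_continuous phi_contr (e := e)); first exact: Cp.
    move=> a b a0 b0; apply: obs_adj_gram; try apply: eP;
      by rewrite ReD /= ltr_wpDr.
  move=> d d0; apply: ne; first by rewrite ReD /= ltr_wpDr // ltW.
  rewrite -subr_eq0 addrAC subrr add0r.
  by apply/eqP => /(congr1 (@complex.Re R)) /= a1; rewrite a1 ltxx in d0.
apply: S_obs => m [w' hw'].
(* A point in both the half-plane of the Gram identity and the component of [m]. *)
pose l := (Num.max w w' + 1)%:C : R[i].
have wl : w < Re l by rewrite /= ltr_pwDr // le_max lexx.
have wl' : half_plane w' l by rewrite /half_plane /= ltr_pwDr // le_max lexx orbT.
pose K := connected_component (res A : set R[i]^o) m.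
(* Were [m] outside the resolvent set, its component would be empty. *)
have mK : K m.
  apply: connected_component_refl; apply: contrapT => nm.
  by have := hw' _ wl'; rewrite connected_component_out.
have Kres : K `<=` res A by exact: connected_component_sub.
have invm := @resolvent_invariance_connected R X A G node_main_subspace K l
  (@component_connected _ _ _) Kres (hw' _ wl') (inv l wl) m mK.
have [z Az xz] := resolventP x0 (Kres _ mK).
set r := resolvent A m x0 in Az xz *.
have Gx : annihilator G x0 by apply/GP.
have Gr : annihilator G r by apply: (invm r z Az); rewrite xz.
exists z; apply: (main_ann l) => //.
have -> : l *: r - z = (l - m) *: r + (m *: r - z) by hilbert_ring.
by apply: GS.2 => //; rewrite xz.
Qed.

End Uniqueness.

(** Rids the uniqueness proof of the rigging. The transfer function is built from choices with
    default 0, so the existence of what they choose must be shown first. *)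
Lemma realization_control (R : realType) (U X Y : hilbertType R)
    (S : set ((X * U) * (X * Y))) (phi : R[i] -> {linear U -> Y}) :
  system_node S -> realization S phi ->
  exists w : R, [/\ 0 <= w, half_plane w `<=` res (main_op S) `&` @Cplus R &
    forall l, w < Re l -> forall u, exists b, S ((b, u), (l *: b, phi l u))].
Proof.
move=> hS [rg [E [w [w_res tf]]]]; exists w; split=> //.
  have [//|w0] := leP 0 w; have [|_ /=] := w_res (w / 2)%:C.
    by rewrite /half_plane /=; lra.
  by rewrite /Cplus /=; lra.
move=> l hl u; have [hres _] := w_res _ hl.
have A_sub := node_main_subspace hS.
have [x hx] := ext_resolvent_exists E (ext_B E u) A_sub hres.
have := tf l hl u; rewrite /transfer_function /ext_resolvent.
case: xgetP => [b _ /= hb|/(_ x)//].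
have [z [y h]] : exists z y, S ((b, u), (z, y)).
  have : dom S (b, u).
    by rewrite (ext_dom E) /=; exists (l *: b); rewrite linearZ /= -hb addrC subrK.
  by move=> [[z y] h]; exists z, y.
rewrite /CD_row; case: xgetP => [y' _ [z' h'] <-|/(_ y)/= []]; last by exists z.
exists b; suff -> : l *: b = z' by [].
have := ext_AB E h'; have -> : ext_A E b + ext_B E u = rig_emb rg (l *: b).
  by rewrite linearZ /= -hb addrC subrK.
move/eqP; rewrite -subr_eq0 -linearB => /eqP e0.
(* The embedding is injective: its norm is that of the resolvent, and a vector with zero resolvent
   image is zero. *)
have := rig_norm rg (l *: b - z'); rewrite e0 normr0 => /esym/normr0_eq0 r0.
have [s [c As] rs] := resolventP (l *: b - z') (rig_beta_res rg).
move: As rs; rewrite r0 => /= As; have [-> _] := node_zero hS As.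
by rewrite scaler0 subr0 => /esym/eqP; rewrite subr_eq0 => /eqP.
Qed.

Lemma model_uniqueness (R : realType) (U Y H X : hilbertType R)
    (phi : R[i] -> {linear U -> Y}) (ev : H -> R[i] -> Y)
    (S : set ((X * U) * (X * Y))) :
  (forall l, Cplus l -> forall u, hn (phi l u) <= hn u) ->
  is_RKHS ev (K_o phi) ->
  system_node S -> observable S -> co_energy_preserving S -> realization S phi ->
  exists2 D : {linear H -> X}, unitary D & intertwines (S_o phi ev) S D.
Proof.
move=> phi_contr H_rkhs hS S_obs S_co S_real.
have [w [w0 w_res S_control]] := realization_control hS S_real.
have Cp l : w < Re l -> Cplus l by move=> /w_res[].
have /choice[e eP] : forall p : R[i] * Y, exists e,
    w < Re p.1 -> obs_adj S p.1 p.2 e.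
  move=> [l y] /=; have [hl|hl] := ltP w (Re l); last by exists 0 => h; lra.
  have [e he] := obs_adj_exists phi_contr hS S_co w_res S_control y hl.
  by exists e.
pose G : set (H * X) := [set p | exists l y, w < Re l /\
  p = (rkernel phi ev l y, e (l, y))].
have [|||D D_unitary DG] := @unitary_of_gram R H X G.
- move=> _ _ [l [y [hl ->]]] [m [y' [hm ->]]] /=.
  apply: (mulfI (Cplus_add_neq0 (Cp _ hl) (Cp _ hm))).
  rewrite (rkernel_gram phi_contr H_rkhs _ _ (Cp _ hl) (Cp _ hm)).
  symmetry; apply: (obs_adj_gram phi_contr hS S_co w_res S_control hl hm).
    exact: (eP (l, y)).
  exact: (eP (m, y')).
- move=> f hf; apply: (ev_half_plane0 phi_contr H_rkhs w0) => l hl.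
  apply: ip_inj => y; rewrite ip0l -(ip_rkernel H_rkhs _ _ (Cp _ hl)) ip_conj.
  by rewrite (hf (rkernel phi ev l y, e (l, y))) ?conjc0 //; exists l, y.
- move=> x hx; apply: (obs_adj_total phi_contr hS S_co w_res S_control S_obs
    (e := fun l y => e (l, y))).
    by move=> l y; exact: (eP (l, y)).
  by move=> l y hl; apply: (hx (rkernel phi ev l y, e (l, y))); exists l, y.
have [[D' DK D'K] D_ip] := D_unitary.
have De f l y : w < Re l -> ip (D f) (e (l, y)) = ip (ev f l) y.
  move=> hl; rewrite -(ip_rkernel H_rkhs _ _ (Cp _ hl)).
  by rewrite -[e (l, y)](DG (rkernel phi ev l y, e (l, y))) ?D_ip //; exists l, y.
have fwd x u z y : S ((D x, u), (D z, y)) -> So_eq phi ev x u z y.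
  move=> h; apply: (So_eq_half_plane phi_contr H_rkhs w0) => m hm.
  apply: ip_inj => y'.
  have := obs_adj_adjoint phi_contr hS w_res S_control hm (eP (m, y') hm) h.
  rewrite /ip2 /= ipZr conjcKE !De // -(schur_adjP phi_contr _ _ (Cp _ hm)) => h1.
  rewrite !(ipDl, ipNl, ipZl) -h1; ring.
have SoP := S_oE phi_contr H_rkhs.
have iff x u z y : S_o phi ev ((x, u), (z, y)) <-> S ((D x, u), (D z, y)).
  split=> [/SoP h|/fwd/SoP //].
  pose a := (w + 1)%:C : R[i].
  have wa : w < Re a by rewrite /= ltrDl ltr01.
  have [hres aC] := w_res _ wa.
  have [s [c As] rs] := resolventP (D (a *: x - z)) hres.
  have [b hb] := S_control a wa u.
  (* The element of [S] with input [u] whose resolvent data at [a] are those of [(x, u)] carried by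
     [D]; [fwd] and uniqueness in the model identify the two. *)
  have Ssum : S ((resolvent (main_op S) a (D (a *: x - z)) + b, u),
      (s + a *: b, c + phi a u)).
    have [[_ lin _] _ _ _] := hS.
    by have := lin 1 _ _ As hb; rewrite /= !scale1r; congr (S _); apply/pair_equal_spec; split; apply/pair_equal_spec; split=> //=; rewrite ?scale1r ?add0r.
  move: Ssum rs; set r := resolvent _ _ _ => Ssum rs.
  rewrite -[r + b]D'K -[s + a *: b]D'K in Ssum.
  have h' := fwd _ _ _ _ Ssum.
  have [|-> -> -> //] := So_resolvent_uniq phi_contr H_rkhs aC h h'.
  apply: (can_inj DK); rewrite [RHS]linearB [D (a *: D' _)]linearZ /= !D'K -rs.
  by hilbert_ring.
exists D => //; split.
  split.
  - by move=> [x u] [[z y] /iff h]; exists (D z, y).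
  - move=> [x u] [x' u'] _ _ [/(can_inj DK) -> ->]; by [].
  - move=> [x u] [[z y] h]; exists (D' x, u); last by rewrite /sum_id /= D'K.
    by exists (D' z, y); apply/iff; rewrite !D'K.
rewrite predeqE => -[[x u] [z y]]; split=> /=.
  by move=> [[z' y'] /iff h [-> ->]].
rewrite /sum_id /= => h; exists (D' z, y); last by rewrite /= D'K.
by apply/iff; rewrite D'K.
Qed.

Theorem theorem1p6 (R : realType) (U Y : hilbertType R)
    (U_separable : separable U) (Y_separable : separable Y)
    (phi : R[i] -> {linear U -> Y}) (phi_schur : schur phi)
    (H : hilbertType R) (ev : H -> R[i] -> Y)
    (H_rkhs : is_RKHS ev (K_o phi)) :
  [/\ (forall x u, dom_So phi ev (x, u) ->
         (exists! y, exists z, So_eq phi ev x u z y) /\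
         (forall y, (exists z, So_eq phi ev x u z y) -> So_lim phi ev x u y)),
      [/\ linear_op (S_o phi ev), dom (S_o phi ev) = dom_So phi ev &
          dense (dom_So phi ev)],
      [/\ system_node (S_o phi ev), observable (S_o phi ev) &
          co_energy_preserving (S_o phi ev)],
      realization (S_o phi ev) phi &
      forall (X : hilbertType R) (S : set ((X * U) * (X * Y))),
        system_node S -> observable S -> co_energy_preserving S ->
        realization S phi ->
        exists2 Delta : {linear H -> X}, unitary Delta &
          intertwines (S_o phi ev) S Delta].
Proof.
have phi_contr l : Cplus l -> forall u, hn (phi l u) <= hn u.
  by case: phi_schur => _ h hl u; rewrite -lecR -!hnE h.
split.
- move=> x u [y [z h]]; split=> [|y' [z' h']].
    exists y; split=> [|y' [z' h']]; first by exists z.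
    by have [] := So_eq_uniq phi_contr H_rkhs h h'.
  exact: (So_eq_lim phi_contr H_rkhs h').
- split; first exact: (So_linear_op phi_contr H_rkhs).
    exact: (dom_SoE phi_contr H_rkhs).
  exact: (So_dom_dense phi_contr H_rkhs).
- split; first exact: (So_system_node phi_contr H_rkhs).
    exact: (So_observable phi_contr H_rkhs).
  exact: (So_co_energy phi_contr H_rkhs).
- exact: (So_realization phi_contr H_rkhs).
- move=> X S; exact: model_uniqueness.
Qed.
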